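(* Let $\rho>1$, $\alpha\in(0,1)$ and $A\in L(H)$. For $\mu>1$ let $f_\mu:S_\mu\to\mathbb{C}$, $f_\mu(z)=z(1-z^{-1})^\alpha$, with range $\operatorname{ran} f_\mu$. The following are equivalent: (i) $\tau(1-\tau^{-1})^\alpha-A$ is invertible in $\ell_{2,\rho}(\mathbb{Z};H)$ with $(\tau(1-\tau^{-1})^\alpha-A)^{-1}\in L(\ell_{2,\rho}(\mathbb{Z};H))$, and this inverse is causal; (ii) $\tau(1-\tau^{-1})^\alpha-A$ is invertible in $\ell_{2,\rho}(\mathbb{Z};H)$ with $(\tau(1-\tau^{-1})^\alpha-A)^{-1}\in L(\ell_{2,\rho}(\mathbb{Z};H))$, and for all $x\in H$ one has $\operatorname{spt}\big((\tau(1-\tau^{-1})^\alpha-A)^{-1}\delta_{-1}x\big)\subseteq\mathbb{N}$; (iii) for all $\mu\ge\rho$, $\operatorname{ran} f_\mu\cap\sigma(A)=\emptyset$.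
   Context: $H$ is a complex separable Hilbert space, $L(X)$ denotes the bounded linear operators on $X$, $\sigma(A)$ the spectrum of $A$, $\mathbb{N}=\{0,1,2,\dots\}$. For $\rho>0$, $S_\rho=\{z\in\mathbb{C}:|z|=\rho\}$ and $\ell_{2,\rho}(\mathbb{Z};H)=\{x\in H^{\mathbb{Z}} : \sum_{k\in\mathbb{Z}}\|x_k\|_H^2\rho^{-2k}<\infty\}$, a Hilbert space with norm $(\sum_k\|x_k\|_H^2\rho^{-2k})^{1/2}$. $\tau$ is the shift $(\tau x)_k=x_{k+1}$, a bounded invertible operator on $\ell_{2,\rho}(\mathbb{Z};H)$. The operator $A\in L(H)$ also denotes the bounded operator $(x_k)_k\mapsto(Ax_k)_k$ on $\ell_{2,\rho}(\mathbb{Z};H)$. For $u\in H^{\mathbb{Z}}$, $\operatorname{spt}u=\{n\in\mathbb{Z}:u_n\ne0\}$. For $x\in H$, $n\in\mathbb{Z}$, $\delta_nx\in H^{\mathbb{Z}}$ is the sequence with value $x$ at index $n$ and $0$ elsewhere. A linear operator $B:\ell_{2,\rho}(\mathbb{Z};H)\to\ell_{2,\rho}(\mathbb{Z};H)$ is causal if for all $a\in\mathbb{Z}$ and $g\in\ell_{2,\rho}(\mathbb{Z};H)$: $\operatorname{spt}g\subseteq\mathbb{Z}_{\ge a}$ implies $\operatorname{spt}Bg\subseteq\mathbb{Z}_{\ge a}$. For $|w|<1$ and $\alpha\in\mathbb{C}$, $(1+w)^\alpha:=\sum_{k=0}^\infty\binom{\alpha}{k}w^k$, where $\binom{\alpha}{0}=1$,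 $\binom{\alpha}{k}=\frac{\alpha(\alpha-1)\cdots(\alpha-k+1)}{k!}$. For $\rho>1$, the operator $(1-\tau^{-1})^\alpha$ on $\ell_{2,\rho}(\mathbb{Z};H)$ is defined as $\mathcal{Z}_\rho^*\,(1-z^{-1})^\alpha\,\mathcal{Z}_\rho$ (multiplication by $(1-z^{-1})^\alpha$ in the middle), where $\mathcal{Z}_\rho:\ell_{2,\rho}(\mathbb{Z};H)\to L_2(S_\rho;H)$ is the unitary transform $x\mapsto(z\mapsto\sum_k x_kz^{-k})$ (the series converging in $L_2(S_\rho;H)$, whose norm is $(\frac1{2\pi}\int_{S_\rho}\|f(z)\|_H^2\frac{|dz|}{|z|})^{1/2}$); equivalently, $((1-\tau^{-1})^\alpha u)_n=\sum_{k=0}^\infty(-1)^k\binom{\alpha}{k}u_{n-k}$ for $n\in\mathbb{Z}$. *)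

(* Defs.v *)
(* Stdlib reals with Coquelicot. *)
From Stdlib Require Export Reals ZArith.
From Coquelicot Require Export Coquelicot.
Open Scope R_scope.

(* The inner product is linear in its first argument; [inner_norm] makes it
   induce the given complete norm, so positive definiteness is inherited. *)
Record HilbertSpace := {
  hilbert_space :> CompleteNormedModule C_AbsRing;
  inner : hilbert_space -> hilbert_space -> C;
  inner_plus_l : forall x y z : hilbert_space,
    inner (plus x y) z = (inner x z + inner y z)%C;
  inner_scal_l : forall (c : C) (x y : hilbert_space),
    inner (scal c x) y = (c * inner x y)%C;
  inner_conj : forall x y : hilbert_space, inner y x = Cconj (inner x y);
  inner_norm : forall x : hilbert_space, inner x x = RtoC (norm x ^ 2)
}.

Definition separable (H : HilbertSpace) : Prop :=
  exists d : nat -> H,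
    forall (x : H) (eps : R), 0 < eps -> exists n : nat, norm (minus x (d n)) < eps.

(* Sum of a convergent series; meaningful only when the series converges. *)
Definition VSeries {V : CompleteNormedModule C_AbsRing} (a : nat -> V) : V :=
  iota (is_series a).

(* Summability over the integers is split into indices >= 0 and indices < 0;
   it is only used for nonnegative terms. *)
Definition ex_zseries (a : Z -> R) : Prop :=
  ex_series (fun n : nat => a (Z.of_nat n)) /\
  ex_series (fun n : nat => a (- Z.of_nat (S n))%Z).

Definition ZSeries (a : Z -> R) : R :=
  Series (fun n : nat => a (Z.of_nat n)) +
  Series (fun n : nat => a (- Z.of_nat (S n))%Z).

(* Linear operators on ell_{2,rho}(Z;H) are represented by functions on all of
   H^Z, of which only the values on [ell2 rho] are ever constrained. *)

Definition ell2 {H : HilbertSpace} (rho : R) (u : Z -> H) : Prop :=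
  ex_zseries (fun k : Z => norm (u k) ^ 2 * powerRZ rho (-2 * k)).

Definition ell2_norm {H : HilbertSpace} (rho : R) (u : Z -> H) : R :=
  sqrt (ZSeries (fun k : Z => norm (u k) ^ 2 * powerRZ rho (-2 * k))).

Record bounded_ell2 {H : HilbertSpace} (rho : R) (B : (Z -> H) -> (Z -> H)) : Prop := {
  bounded_ell2_maps : forall u, ell2 rho u -> ell2 rho (B u);
  bounded_ell2_plus : forall u v, ell2 rho u -> ell2 rho v ->
    forall n : Z, B (fun k => plus (u k) (v k)) n = plus (B u n) (B v n);
  bounded_ell2_scal : forall (c : C) u, ell2 rho u ->
    forall n : Z, B (fun k => scal c (u k)) n = scal c (B u n);
  bounded_ell2_norm : exists M : R,
    forall u, ell2 rho u -> ell2_norm rho (B u) <= M * ell2_norm rho u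
}.

Record bounded_inverse_ell2 {H : HilbertSpace} (rho : R)
    (T S : (Z -> H) -> (Z -> H)) : Prop := {
  bounded_inverse_maps : forall u, ell2 rho u -> ell2 rho (T u);
  bounded_inverse_bounded : bounded_ell2 rho S;
  bounded_inverse_l : forall u, ell2 rho u -> forall n : Z, S (T u) n = u n;
  bounded_inverse_r : forall u, ell2 rho u -> forall n : Z, T (S u) n = u n
}.

Definition spt {H : HilbertSpace} (u : Z -> H) (n : Z) : Prop := u n <> zero.

Definition delta {H : HilbertSpace} (n : Z) (x : H) : Z -> H :=
  fun k => if Z.eq_dec k n then x else zero.

Definition causal {H : HilbertSpace} (rho : R) (B : (Z -> H) -> (Z -> H)) : Prop :=
  forall (a : Z) (g : Z -> H), ell2 rho g ->
    (forall n : Z, spt g n -> (a <= n)%Z) ->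
    forall n : Z, spt (B g) n -> (a <= n)%Z.

Definition shift {H : HilbertSpace} (u : Z -> H) : Z -> H := fun k => u (k + 1)%Z.

Fixpoint falling_factorial (alpha : C) (k : nat) : C :=
  match k with
  | O => RtoC 1
  | S j => (falling_factorial alpha j * (alpha - RtoC (INR j)))%C
  end.

Definition binom (alpha : C) (k : nat) : C :=
  (falling_factorial alpha k / RtoC (INR (fact k)))%C.

(* (1 + w)^alpha for |w| < 1. *)
Definition one_plus_pow (w alpha : C) : C :=
  VSeries (V := C_CompleteNormedModule) (fun k : nat => (binom alpha k * Cpow w k)%C).

(* (1 - tau^{-1})^alpha. The operator Z_rho^* (1 - z^{-1})^alpha Z_rho acts on
   ell_{2,rho}(Z;H), rho > 1, as convolution with the coefficients
   (-1)^k binom(alpha,k) of the binomial series of (1 - z^{-1})^alpha; this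
   convolution, whose series converges for u in ell_{2,rho}, is the form used
   here. *)
Definition frac_diff {H : HilbertSpace} (alpha : C) (u : Z -> H) : Z -> H :=
  fun n => VSeries (fun k : nat =>
    scal (Cpow (RtoC (-1)) k * binom alpha k)%C (u (n - Z.of_nat k)%Z)).

(* tau (1 - tau^{-1})^alpha - A *)
Definition frac_op {H : HilbertSpace} (alpha : C) (A : H -> H)
    (u : Z -> H) : Z -> H :=
  fun n => minus (shift (frac_diff alpha u) n) (A (u n)).

Definition spectrum {H : HilbertSpace} (A : H -> H) (lambda : C) : Prop :=
  ~ exists B : H -> H, is_linear B /\
      (forall x : H, B (minus (scal lambda x) (A x)) = x) /\
      (forall x : H, minus (scal lambda (B x)) (A (B x)) = x).

(* f_mu (z) = z (1 - z^{-1})^alpha; its range is taken over S_mu. *)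
Definition f_frac (alpha z : C) : C := (z * one_plus_pow (- / z) alpha)%C.

Definition ran_f (alpha : C) (mu : R) (lambda : C) : Prop :=
  exists z : C, Cmod z = mu /\ lambda = f_frac alpha z.

(* Main.v *)
Require Import Defs.
From Stdlib Require Import Lra Lia Classical IndefiniteDescription
  FunctionalExtensionality ssreflect.

(** Write r = 1/rho, w = 1/z and let c_k be the coefficients of (1 - w)^alpha, so
that |c_k| <= 1. The operator T = tau (1 - tau^{-1})^alpha - A is the shift of
the convolution with symbol P(w) = (1 - w)^alpha - w A, and
P(w) = w (f(1/w) - A) for w <> 0, where f(z) = z (1 - z^{-1})^alpha. Since
P(0) = 1, the spectral condition says exactly that P(w) is invertible on the
closed disc |w| <= r.

From the spectrum to a causal inverse ([frac_op_causal_inverse]). By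
compactness of the disc, |x| <= M |P(w) x| with one constant M
([pencil_uniform]). If the symbol is a polynomial in w, Parseval's identity on
roots of unity turns this bound into |u| <= M |P_t u| for the convolution P_t
with symbol P(t w), with the same M for every t in [0,r]
([conv_coercive]). At t = 0 this convolution is the identity, and the uniform
bound lets Neumann series ([solvable_perturb]) carry surjectivity from t = 0 to
t = r in finitely many equal steps ([conv_solvable]). Every step can be made
inside the closed subspace of the sequences that vanish before a given index,
and the inverses agree there by uniqueness: this is causality. A last
perturbation passes from the truncated binomial series to the full one
([pencil_op_invertible]). Connectedness of [0,r] stands in for Cauchy's theorem
applied to the inverse of P.

From a causal inverse S to the spectrum ([strictly_causal_spectrum]). The
leading coefficient of T is c_0 = 1 one step to the left, so a causal inverse
delays supports by one step ([causal_inverse_strict]); conversely, S commutes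
with shifts, and continuity extends the delay from unit impulses to all inputs
([strictly_causal_of_delta]). For |w| < r let g_x be the half-line sequence
z^n x, n <= 0. A strictly causal S maps it to z^n (Y x) on the same half-line,
and Y is the inverse of f(z) - A; moreover |Y| <= |S|, because g_x has norm
K |x| with a constant K that cancels ([resolvent_outside]). The bound does not
depend on z, so it survives the limit |z| -> rho, which settles the boundary
circle ([resolvent_open]).

The space of square-summable sequences is never built as a type: [l2le u c]
says that u has norm at most c, and it combines membership and bound. Weights
rho^{-n} are moved into the sequence by [weighted]. *)

(** * Algebra in modules over the complex numbers *)

Ltac cring := match goal with |- @eq _ ?a ?b => change (@eq C a b) end; ring.
Ltac cfield := match goal with |- @eq _ ?a ?b => change (@eq C a b) end; field.

Lemma minus_cancel_r {G : AbelianGroup} (a b c : G) :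
  minus (minus a c) (minus b c) = minus a b.
Proof.
  unfold minus. rewrite opp_plus opp_opp -!plus_assoc. f_equal.
  by rewrite (plus_comm (opp b)) plus_assoc plus_opp_l plus_zero_l.
Qed.

Lemma minus_cancel_l {G : AbelianGroup} (a b c : G) :
  minus (minus a c) (minus a b) = minus b c.
Proof.
  unfold minus. rewrite opp_plus opp_opp (plus_comm a) -plus_assoc.
  by rewrite (plus_assoc a) plus_opp_r plus_zero_l plus_comm.
Qed.

Lemma minus_minus_swap {G : AbelianGroup} (a b c d : G) :
  minus (minus a b) (minus c d) = minus (minus a c) (minus b d).
Proof.
  unfold minus. rewrite !opp_plus !opp_opp -!plus_assoc. f_equal.
  rewrite !plus_assoc. f_equal. apply plus_comm.
Qed.

Lemma minus_plus_plus {G : AbelianGroup} (a b c d : G) :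
  minus (plus a b) (plus c d) = plus (minus a c) (minus b d).
Proof.
  unfold minus. rewrite opp_plus -!plus_assoc. f_equal.
  rewrite !plus_assoc. f_equal. apply plus_comm.
Qed.

Lemma minus_plus_cancel {G : AbelianGroup} (a b : G) : plus (minus a b) b = a.
Proof. unfold minus. by rewrite -plus_assoc plus_opp_l plus_zero_r. Qed.

Lemma sum_n_single {G : AbelianMonoid} (a : nat -> G) j N :
  (j <= N)%nat -> (forall l, l <> j -> a l = zero) -> sum_n a N = a j.
Proof.
  intros hj h.
  assert (k : forall M, (M < j)%nat -> sum_n a M = zero).
  { induction M as [|M IH]; intros hM.
    - rewrite sum_O. apply h; lia.
    - rewrite sum_Sn IH; [|lia]. rewrite plus_zero_l. apply h; lia. }
  induction N as [|N IH].
  - rewrite sum_O. f_equal; lia.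
  - rewrite sum_Sn. destruct (Nat.eq_dec j (S N)) as [->|hn].
    + rewrite k; [|lia]. apply plus_zero_l.
    + rewrite IH; [|lia]. rewrite (h (S N)); [|lia]. apply plus_zero_r.
Qed.

(** Reindexing behind the convolution theorem: delaying a sequence by k steps does
not change its sum as long as nothing is pushed out of the summation range. *)
Lemma sum_n_delay {G : AbelianMonoid} (a b : nat -> G) k M :
  (forall j, (j < k)%nat -> b j = zero) -> (forall j, b (k + j)%nat = a j) ->
  (forall j, (M < j)%nat -> a j = zero) ->
  sum_n b (k + M) = sum_n a (k + M).
Proof.
  intros h1 h2 h3.
  transitivity (sum_n a M).
  - clear h3. induction M as [|M IH].
    + rewrite sum_O -h2 Nat.add_0_r. destruct k as [|k]; [now rewrite sum_O|].
      rewrite sum_Sn.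
      replace (sum_n b k) with (zero : G); [apply plus_zero_l|].
      clear h2. induction k as [|k IH].
      * rewrite sum_O. symmetry; apply h1; lia.
      * rewrite sum_Sn -IH; [|intros j hj; apply h1; lia].
        rewrite plus_zero_l. symmetry; apply h1; lia.
    + rewrite Nat.add_succ_r !sum_Sn IH -h2. now rewrite Nat.add_succ_r.
  - clear h1 h2. induction k as [|k IH]; [easy|].
    rewrite sum_Sn -IH (h3 (S (k + M))); [|lia]. now rewrite plus_zero_r.
Qed.

Lemma sum_n_Rmult_l c (a : nat -> R) N : sum_n (fun k => c * a k) N = c * sum_n a N.
Proof. exact (sum_n_mult_l (K := R_Ring) c a N). Qed.

Lemma sum_n_Rmult_r c (a : nat -> R) N : sum_n (fun k => a k * c) N = sum_n a N * c.
Proof. exact (sum_n_mult_r (K := R_Ring) c a N). Qed.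

Lemma RtoC_sum_n (f : nat -> R) N : RtoC (sum_n f N) = sum_n (fun j => RtoC (f j)) N.
Proof.
  induction N as [|N IH]; [now rewrite !sum_O|].
  rewrite !sum_Sn. change (@plus R_AbelianMonoid) with Rplus.
  now rewrite RtoC_plus IH.
Qed.

Lemma norm_scal_C {V : NormedModule C_AbsRing} (c : C) (x : V) :
  norm (scal c x) <= Cmod c * norm x.
Proof. exact (norm_scal c x). Qed.

Lemma scal_Cmult {V : NormedModule C_AbsRing} (a b : C) (x : V) :
  scal a (scal b x) = scal (a * b)%C x.
Proof. exact (scal_assoc a b x). Qed.

Lemma norm_scal_C_eq {V : NormedModule C_AbsRing} (c : C) (x : V) :
  norm (scal c x) = Cmod c * norm x.
Proof.
  apply Rle_antisym; [apply norm_scal_C|].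
  destruct (classic (c = RtoC 0)) as [->|hc].
  - rewrite Cmod_0 Rmult_0_l. apply norm_ge_0.
  - assert (h : norm x <= Cmod (/ c) * norm (scal c x)).
    { replace x with (scal (/ c)%C (scal c x)) at 1; [apply norm_scal_C|].
      rewrite scal_Cmult Cinv_l; [exact (scal_one x)|easy]. }
    rewrite Cmod_inv in h; [|easy]. apply Cmod_gt_0 in hc.
    apply Rmult_le_reg_l with (/ Cmod c); [now apply Rinv_0_lt_compat|].
    rewrite -Rmult_assoc Rinv_l; lra.
Qed.

Section Linear.
Context {V W : NormedModule C_AbsRing} (f : V -> W) (hf : is_linear f).

Lemma linear_sum_n (a : nat -> V) N : f (sum_n a N) = sum_n (fun j => f (a j)) N.
Proof.
  induction N as [|N IH]; [now rewrite !sum_O|].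
  now rewrite !sum_Sn (linear_plus f hf) IH.
Qed.

Lemma linear_bound_nonneg : exists b, 0 <= b /\ forall x, norm (f x) <= b * norm x.
Proof. destruct (linear_norm f hf) as (b & hb & h). exists b; split; [lra|easy]. Qed.

Lemma linear_map_zero : f zero = zero.
Proof. exact (linear_zero f hf). Qed.

Lemma linear_map_opp x : f (opp x) = opp (f x).
Proof. exact (linear_opp f x hf). Qed.
End Linear.

Lemma norm_minus_self {V : NormedModule C_AbsRing} (x : V) : norm (minus x x) = 0.
Proof. by rewrite minus_eq_zero norm_zero. Qed.

(** * Window sums and square-summable sequences *)

(** Windows start at an arbitrary integer, so that bounding all of them is a
translation-invariant condition. *)
Fixpoint window_sum (f : Z -> R) (a : Z) (L : nat) : R :=
  match L with
  | O => 0
  | S l => f a + window_sum f (a + 1)%Z l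
  end.

(** Membership in the square-summable sequences together with the norm bound c.
Being a family of bounds on finite sums, it needs no convergence argument to be
stable under sums, shifts and pointwise limits. *)
Definition l2le {V : NormedModule C_AbsRing} (u : Z -> V) (c : R) : Prop :=
  0 <= c /\ forall a L, window_sum (fun n => norm (u n) ^ 2) a L <= c ^ 2.

Lemma window_sum_ext f g a L :
  (forall n, (a <= n < a + Z.of_nat L)%Z -> f n = g n) ->
  window_sum f a L = window_sum g a L.
Proof.
  revert a; induction L as [|L IH]; intros a h; simpl; [easy|].
  rewrite -> h by lia. rewrite -> IH; [easy|]. intros n hn; apply h; lia.
Qed.

Lemma window_sum_le f g a L :
  (forall n, f n <= g n) -> window_sum f a L <= window_sum g a L.
Proof.
  intros h; revert a; induction L as [|L IH]; intros a; simpl; [lra|].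
  specialize (h a); specialize (IH (a + 1)%Z); lra.
Qed.

Lemma window_sum_zero a L : window_sum (fun _ => 0) a L = 0.
Proof. revert a; induction L as [|L IH]; intros a; simpl; [easy|]. rewrite -> IH; lra. Qed.

Lemma window_sum_ge0 f a L : (forall n, 0 <= f n) -> 0 <= window_sum f a L.
Proof.
  intros h. rewrite <- (window_sum_zero a L). now apply window_sum_le.
Qed.

Lemma window_sum_cat f a L1 L2 :
  window_sum f a (L1 + L2) = window_sum f a L1 + window_sum f (a + Z.of_nat L1)%Z L2.
Proof.
  revert a; induction L1 as [|L IH]; intros a.
  - simpl. replace (a + 0)%Z with a by lia. lra.
  - cbn [Nat.add window_sum]. rewrite -> IH.
    replace (a + 1 + Z.of_nat L)%Z with (a + Z.of_nat (S L))%Z by lia. lra.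
Qed.

Lemma window_sum_scal c f a L :
  window_sum (fun n => c * f n) a L = c * window_sum f a L.
Proof. revert a; induction L as [|L IH]; intros a; simpl; [ring|]. rewrite -> IH; ring. Qed.

Lemma window_sum_shift f m a L :
  window_sum (fun n => f (n + m)%Z) a L = window_sum f (a + m)%Z L.
Proof.
  revert a; induction L as [|L IH]; intros a; simpl; [ring|]. rewrite -> IH.
  now replace (a + 1 + m)%Z with (a + m + 1)%Z by lia.
Qed.

(** Enlarging the window adds nonnegative terms on both sides. *)
Lemma window_sum_incl f a L b K :
  (forall n, 0 <= f n) -> (b <= a)%Z -> (a + Z.of_nat L <= b + Z.of_nat K)%Z ->
  window_sum f a L <= window_sum f b K.
Proof.
  intros hf h1 h2.
  replace K with (Z.to_nat (a - b) + (L + (K - L - Z.to_nat (a - b))))%nat by lia.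
  rewrite -> !window_sum_cat.
  replace (b + Z.of_nat (Z.to_nat (a - b)))%Z with a by lia.
  pose proof (window_sum_ge0 f b (Z.to_nat (a - b)) hf).
  pose proof (window_sum_ge0 f (a + Z.of_nat L) (K - L - Z.to_nat (a - b)) hf).
  lra.
Qed.

(** Both windows sit in a common larger one, over which the sum is that of the
window carrying the support. *)
Lemma window_sum_supp f a L b K :
  (forall n, 0 <= f n) -> (forall n, ~ (a <= n < a + Z.of_nat L)%Z -> f n = 0) ->
  window_sum f b K <= window_sum f a L.
Proof.
  intros hf h0.
  pose (c := Z.min a b).
  pose (N := (Z.to_nat (a - c) + L + Z.to_nat (b - c) + K)%nat).
  apply Rle_trans with (window_sum f c N).
  { apply window_sum_incl; [easy| |]; unfold N, c; lia. }
  unfold N.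
  replace (Z.to_nat (a - c) + L + Z.to_nat (b - c) + K)%nat
    with (Z.to_nat (a - c) + (L + (Z.to_nat (b - c) + K)))%nat by lia.
  set (q := (Z.to_nat (b - c) + K)%nat). rewrite -> !window_sum_cat.
  replace (c + Z.of_nat (Z.to_nat (a - c)))%Z with a by (unfold c; lia).
  rewrite -> (window_sum_ext _ (fun _ => 0) c), window_sum_zero
    by (intros n hn; apply h0; unfold c in *; lia).
  rewrite -> (window_sum_ext _ (fun _ => 0) (a + Z.of_nat L)), window_sum_zero
    by (intros n hn; apply h0; unfold c in *; lia).
  lra.
Qed.

Lemma window_sum_sum_n f a N :
  window_sum f a (S N) = sum_n (fun j => f (a + Z.of_nat j)%Z) N.
Proof.
  induction N as [|N IH].
  - rewrite sum_O. simpl. rewrite Z.add_0_r. ring.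
  - replace (S (S N)) with (S N + 1)%nat by lia.
    rewrite window_sum_cat IH sum_Sn. unfold plus; simpl. ring.
Qed.

Lemma sqrt_minkowski a b c d :
  sqrt ((a + b) ^ 2 + (c + d) ^ 2) <= sqrt (a ^ 2 + c ^ 2) + sqrt (b ^ 2 + d ^ 2).
Proof.
  pose proof (pow2_ge_0 a). pose proof (pow2_ge_0 b).
  pose proof (pow2_ge_0 c). pose proof (pow2_ge_0 d).
  assert (e1 := pow2_sqrt (a ^ 2 + c ^ 2) ltac:(lra)).
  assert (e2 := pow2_sqrt (b ^ 2 + d ^ 2) ltac:(lra)).
  pose proof (sqrt_pos (a ^ 2 + c ^ 2)) as p1. pose proof (sqrt_pos (b ^ 2 + d ^ 2)) as p2.
  set (x := sqrt (a ^ 2 + c ^ 2)) in *. set (y := sqrt (b ^ 2 + d ^ 2)) in *.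
  rewrite <- (sqrt_pow2 (x + y)) by lra.
  apply sqrt_le_1_alt.
  assert (a * b + c * d <= x * y).
  { apply Rle_trans with (Rabs (a * b + c * d)); [apply Rle_abs|].
    apply Rsqr_incr_0_var; [|nra].
    rewrite <- Rsqr_abs. unfold Rsqr.
    replace (x * y * (x * y)) with (x ^ 2 * y ^ 2) by ring.
    rewrite -> e1, e2. pose proof (pow2_ge_0 (a * d - b * c)). nra. }
  nra.
Qed.

Lemma window_minkowski (f g : Z -> R) a L :
  sqrt (window_sum (fun n => (f n + g n) ^ 2) a L) <=
  sqrt (window_sum (fun n => f n ^ 2) a L) + sqrt (window_sum (fun n => g n ^ 2) a L).
Proof.
  revert a; induction L as [|L IH]; intros a; cbn [window_sum]; [rewrite -> sqrt_0; lra|].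
  assert (p : forall h : Z -> R, 0 <= window_sum (fun n => h n ^ 2) (a + 1)%Z L)
    by (intros h; apply window_sum_ge0; intros; apply pow2_ge_0).
  specialize (IH (a + 1)%Z).
  rewrite <- (pow2_sqrt _ (p f)) at 1. rewrite <- (pow2_sqrt _ (p g)) at 1.
  eapply Rle_trans; [|apply sqrt_minkowski].
  apply sqrt_le_1_alt, Rplus_le_compat_l.
  rewrite <- (pow2_sqrt _ (p (fun n => f n + g n))).
  apply pow_incr; split; [apply sqrt_pos|easy].
Qed.

Section L2.
Context {V : NormedModule C_AbsRing}.
Implicit Types (u v : Z -> V) (c d : R).

Lemma l2le_sqrt u c : l2le u c <->
  0 <= c /\ forall a L, sqrt (window_sum (fun n => norm (u n) ^ 2) a L) <= c.
Proof.
  unfold l2le; split; intros [hc h]; split; try easy; intros a L; specialize (h a L).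
  - rewrite <- (sqrt_pow2 c) by easy. now apply sqrt_le_1_alt.
  - rewrite <- (pow2_sqrt (window_sum _ _ _))
      by (apply window_sum_ge0; intros; apply pow2_ge_0).
    apply pow_incr; split; [apply sqrt_pos|easy].
Qed.

Lemma l2le_dom {W : NormedModule C_AbsRing} u (v : Z -> W) c :
  (forall n, norm (v n) <= norm (u n)) -> l2le u c -> l2le v c.
Proof.
  intros h [hc hu]; split; [easy|]; intros a L.
  eapply Rle_trans; [|apply (hu a L)]. apply window_sum_le; intros n.
  apply pow_incr; split; [apply norm_ge_0|apply h].
Qed.

Lemma l2le_plus u v c d :
  l2le u c -> l2le v d -> l2le (fun n => plus (u n) (v n)) (c + d).
Proof.
  rewrite -> !l2le_sqrt; intros [hc hu] [hd hv]; split; [lra|]; intros a L.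
  eapply Rle_trans; [|apply Rplus_le_compat; [apply (hu a L)|apply (hv a L)]].
  eapply Rle_trans; [|apply window_minkowski].
  apply sqrt_le_1_alt, window_sum_le; intros n.
  apply pow_incr; split; [apply norm_ge_0|apply norm_triangle].
Qed.

Lemma l2le_map {W : NormedModule C_AbsRing} u (v : Z -> W) m c :
  0 <= m -> (forall n, norm (v n) <= m * norm (u n)) -> l2le u c -> l2le v (m * c).
Proof.
  intros hm h [hc hu]; split; [nra|]; intros a L.
  rewrite -> Rpow_mult_distr.
  apply Rle_trans with (m ^ 2 * window_sum (fun n => norm (u n) ^ 2) a L).
  - rewrite <- window_sum_scal. apply window_sum_le; intros n.
    rewrite <- Rpow_mult_distr. apply pow_incr; split; [apply norm_ge_0|apply h].
  - apply Rmult_le_compat_l; [apply pow2_ge_0|apply hu].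
Qed.

Lemma l2le_opp u c : l2le u c -> l2le (fun n => opp (u n)) c.
Proof. apply l2le_dom; intros n; rewrite -> norm_opp; lra. Qed.

Lemma l2le_minus u v c d :
  l2le u c -> l2le v d -> l2le (fun n => minus (u n) (v n)) (c + d).
Proof. intros hu hv; apply l2le_plus; [easy|now apply l2le_opp]. Qed.

Lemma l2le_shift u c m : l2le u c -> l2le (fun n => u (n + m)%Z) c.
Proof.
  intros [hc hu]; split; [easy|]; intros a L.
  rewrite -> (window_sum_shift (fun n => norm (u n) ^ 2)). apply hu.
Qed.

Lemma l2le_weaken u c d : c <= d -> l2le u c -> l2le u d.
Proof.
  intros h [hc hu]; split; [lra|]; intros a L.
  eapply Rle_trans; [apply hu|]. apply pow_incr; lra.
Qed.

Lemma l2le_ext u v c : (forall n, u n = v n) -> l2le u c -> l2le v c.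
Proof. intros h; apply l2le_dom; intros n; rewrite -> h; lra. Qed.

Lemma l2le_zero : l2le (fun _ => zero : V) 0.
Proof.
  split; [lra|]; intros a L. right. rewrite -> (window_sum_ext _ (fun _ => 0)).
  - rewrite -> window_sum_zero; ring.
  - intros; rewrite -> norm_zero; ring.
Qed.

Lemma l2le_norm u c n : l2le u c -> norm (u n) <= c.
Proof.
  intros [hc h]. specialize (h n 1%nat); simpl in h.
  pose proof (norm_ge_0 (u n)). nra.
Qed.

Lemma l2le_closed u c : (forall eps, 0 < eps -> l2le u (c + eps)) -> l2le u c.
Proof.
  rewrite -> l2le_sqrt. intros h.
  assert (k : forall x, (forall eps, 0 < eps -> x <= c + eps) -> x <= c).
  { intros x hx; apply Rnot_lt_le; intros hlt. specialize (hx ((x - c) / 2)). lra. }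
  split.
  - apply k; intros e he; apply (h e he).
  - intros a L; apply k; intros e he. specialize (h e he).
    rewrite -> l2le_sqrt in h; apply h.
Qed.

Lemma window_sum_lim (f : nat -> Z -> R) (g : Z -> R) a L :
  (forall n, is_lim_seq (fun j => f j n) (g n)) ->
  is_lim_seq (fun j => window_sum (f j) a L) (window_sum g a L).
Proof.
  intros h; revert a; induction L as [|L IH]; intros a; simpl.
  - apply is_lim_seq_const.
  - now apply is_lim_seq_plus'.
Qed.

(** Fatou-type closure: every window sum is a finite sum of continuous functions of
the entries. *)
Lemma l2le_lim (w : nat -> Z -> V) u c :
  (forall n, filterlim (fun j => w j n) eventually (locally (u n))) ->
  (forall j, l2le (w j) c) -> l2le u c.
Proof.
  intros hw h; split; [apply (h 0%nat)|]; intros a L.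
  apply (is_lim_seq_le (fun j => window_sum (fun n => norm (w j n) ^ 2) a L)
           (fun _ => c ^ 2) (window_sum (fun n => norm (u n) ^ 2) a L) (c ^ 2)).
  - intros j; apply (h j).
  - apply (window_sum_lim (fun j n => norm (w j n) ^ 2)). intros n. simpl.
    assert (k : is_lim_seq (fun j => norm (w j n)) (norm (u n)))
      by (eapply filterlim_comp; [apply hw|apply filterlim_norm]).
    apply is_lim_seq_mult'; [easy|].
    apply is_lim_seq_mult'; [easy|apply is_lim_seq_const].
  - apply is_lim_seq_const.
Qed.

Lemma l2le_sum (w : nat -> Z -> V) (c : nat -> R) J :
  (forall j, (j <= J)%nat -> l2le (w j) (c j)) ->
  l2le (fun n => sum_n (fun j => w j n) J) (sum_n c J).
Proof.
  induction J as [|J IH]; intros h.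
  - apply (l2le_ext (w 0%nat)); [intros; now rewrite -> sum_O|].
    rewrite -> sum_O. now apply h.
  - rewrite -> sum_Sn.
    apply (l2le_ext (fun n => plus (sum_n (fun j => w j n) J) (w (S J) n)));
      [intros; now rewrite -> sum_Sn|].
    apply l2le_plus; [apply IH; intros; apply h; lia|apply h; lia].
Qed.

Definition trunc (N : nat) u : Z -> V :=
  fun n => if (Z.abs n <=? Z.of_nat N)%Z then u n else zero.

Lemma l2le_trunc N u c : l2le u c -> l2le (trunc N u) c.
Proof.
  apply l2le_dom; intros n; unfold trunc; destruct (Z.leb_spec (Z.abs n) (Z.of_nat N)); [lra|].
  rewrite -> norm_zero; apply norm_ge_0.
Qed.

(** The sums over [-N,N] increase and stay bounded, hence form a Cauchy sequence; a
window of the difference is dominated by the increment of these sums. *)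
Lemma l2le_tail u c eps : l2le u c -> 0 < eps ->
  exists N, l2le (fun n => minus (u n) (trunc N u n)) eps.
Proof.
  intros [hc hu] heps.
  set (f := fun n => norm (u n) ^ 2).
  assert (hf : forall n, 0 <= f n) by (intros; apply pow2_ge_0).
  pose (s := fun N : nat => window_sum f (- Z.of_nat N) (2 * N + 1)).
  assert (hs : ex_finite_lim_seq s).
  { apply (ex_finite_lim_seq_incr s (c ^ 2)).
    - intros n; unfold s; apply window_sum_incl; [easy|lia|lia].
    - intros n; apply hu. }
  apply ex_lim_seq_cauchy_corr in hs.
  assert (he : 0 < eps ^ 2) by (apply pow_lt; lra).
  destruct (hs (mkposreal _ he)) as [N hN]; simpl in hN.
  exists N; split; [lra|]; intros a L.
  pose (N' := (N + Z.to_nat (Z.abs a) + L)%nat).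
  pose (g := fun n => if (Z.abs n <=? Z.of_nat N)%Z then 0 else f n).
  rewrite -> (window_sum_ext _ g).
  2:{ intros n _; unfold g, trunc, f; destruct (Z.leb_spec (Z.abs n) (Z.of_nat N)).
      - rewrite norm_minus_self; ring.
      - now rewrite minus_zero_r. }
  apply Rle_trans with (window_sum g (- Z.of_nat N') (2 * N' + 1)).
  { apply window_sum_incl; [|unfold N'; lia|unfold N'; lia].
    intros n; unfold g; destruct (Z.leb_spec (Z.abs n) (Z.of_nat N)); [lra|easy]. }
  assert (e : s N' = s N + window_sum g (- Z.of_nat N') (2 * N' + 1)).
  { unfold s.
    replace (2 * N' + 1)%nat with ((N' - N) + ((2 * N + 1) + (N' - N)))%nat
      by (unfold N'; lia).
    remember (2 * N + 1)%nat as q eqn:hq.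
    rewrite -> !window_sum_cat.
    replace (- Z.of_nat N' + Z.of_nat (N' - N))%Z with (- Z.of_nat N)%Z by (unfold N'; lia).
    rewrite -> (window_sum_ext g f (- Z.of_nat N')) by
      (intros n hn; unfold g; destruct (Z.leb_spec (Z.abs n) (Z.of_nat N));
       [exfalso; unfold N' in *; lia|easy]).
    rewrite -> (window_sum_ext g f (- Z.of_nat N + Z.of_nat q)%Z) by
      (intros n hn; unfold g; destruct (Z.leb_spec (Z.abs n) (Z.of_nat N));
       [exfalso; unfold N' in *; lia|easy]).
    rewrite -> (window_sum_ext g (fun _ => 0) (- Z.of_nat N)%Z) by
      (intros n hn; unfold g; destruct (Z.leb_spec (Z.abs n) (Z.of_nat N));
       [easy|exfalso; lia]).
    rewrite -> window_sum_zero. ring. }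
  specialize (hN N' N ltac:(unfold N'; lia) ltac:(lia)).
  apply Rabs_def2 in hN. simpl in *. lra.
Qed.

End L2.

(** * Series and perturbation of invertible operators *)

Section VSeries.
Context {V : CompleteNormedModule C_AbsRing}.
Implicit Types (a : nat -> V) (l : V).

Lemma is_series_inj a l m : is_series a l -> is_series a m -> l = m.
Proof. apply (filterlim_locally_unique (sum_n a)). Qed.

Lemma VSeries_unique a l : is_series a l -> VSeries a = l.
Proof.
  intros h. apply iota_unique; [|easy]. intros y hy. exact (is_series_inj a y l hy h).
Qed.

Lemma VSeries_correct a : ex_series a -> is_series a (VSeries a).
Proof. intros [l h]. now rewrite (VSeries_unique a l h). Qed.

Lemma norm_series_le a l c :
  is_series a l -> (forall n, norm (sum_n a n) <= c) -> norm l <= c.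
Proof.
  intros h hc.
  apply (is_lim_seq_le (fun n => norm (sum_n a n)) (fun _ => c) (norm l) c); [easy| |].
  - eapply filterlim_comp; [exact h|apply filterlim_norm].
  - apply is_lim_seq_const.
Qed.

Lemma norm_sum_n_le (a : nat -> V) (b : nat -> R) n :
  (forall k, norm (a k) <= b k) -> norm (sum_n a n) <= sum_n b n.
Proof.
  intros h; induction n as [|n IH].
  - now rewrite !sum_O.
  - rewrite !sum_Sn. eapply Rle_trans; [apply (norm_triangle (V := V))|].
    now apply Rplus_le_compat.
Qed.
End VSeries.

Lemma sum_geom_half c J K : 0 <= c ->
  sum_n (fun i => c / 2 ^ (S J + i)) K <= c / 2 ^ J.
Proof.
  intros hc.
  assert (e : sum_n (fun i => c / 2 ^ (S J + i)) K = c / 2 ^ J - c / 2 ^ (S J + K)).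
  { induction K as [|K IH].
    - rewrite sum_O. rewrite Nat.add_0_r. simpl. field. apply pow_nonzero; lra.
    - rewrite sum_Sn IH. rewrite Nat.add_succ_r. unfold plus; simpl. field.
      split; apply pow_nonzero; lra. }
  rewrite e. assert (0 <= c / 2 ^ (S J + K)); [|lra].
  apply Rdiv_le_0_compat; [easy|apply pow_lt; lra].
Qed.

Lemma ex_series_half c : ex_series (fun j => c / 2 ^ j).
Proof.
  apply (ex_series_ext (fun j => scal c ((/ 2) ^ j))).
  - intros j. rewrite pow_inv. reflexivity.
  - apply (ex_series_scal_l (K := R_AbsRing) (V := R_NormedModule)).
    exists (/ (1 - / 2)). apply is_series_geom. rewrite Rabs_pos_eq; lra.
Qed.

Section Neumann.
Context {V : CompleteNormedModule C_AbsRing}.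
Implicit Types (u g : Z -> V) (T : (Z -> V) -> Z -> V).

(** Completeness in the form used by Neumann series. The limit is the entrywise sum,
so it inherits the common zeros of the terms. *)
Lemma l2_complete (w : nat -> Z -> V) c :
  (forall j, l2le (w j) (c / 2 ^ j)) ->
  exists u, (forall n, (forall j, w j n = zero) -> u n = zero) /\
    forall J, l2le (fun n => minus (u n) (sum_n (fun j => w j n) J)) (c / 2 ^ J).
Proof.
  intros hw.
  assert (hc : 0 <= c). { destruct (hw 0%nat) as [h _]; simpl in h; lra. }
  assert (hs : forall n, is_series (fun j => w j n) (VSeries (fun j => w j n))).
  { intros n. apply VSeries_correct.
    apply (ex_series_le (K := C_AbsRing) (V := V) _ (fun j => c / 2 ^ j)).
    - intros j. apply l2le_norm, hw.
    - apply ex_series_half. }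
  exists (fun n => VSeries (fun j => w j n)); split.
  - intros n hn. apply VSeries_unique.
    apply (is_series_ext (fun _ => zero)); [intros j; now rewrite hn|].
    apply (filterlim_ext (fun _ => zero)); [|apply filterlim_const].
    intros N; induction N as [|N IH]; [now rewrite sum_O|].
    now rewrite sum_Sn -IH plus_zero_l.
  - intros J.
    apply (l2le_lim (fun K n => sum_n (fun i => w (S J + i)%nat n) K)).
    + intros n.
      refine (is_series_incr_n (fun j => w j n) (S J) _ _ _); [lia|].
      replace (plus _ _) with (VSeries (fun j => w j n)); [apply hs|].
      simpl pred. by rewrite minus_plus_cancel.
    + intros K. apply (l2le_weaken _ _ _ (sum_geom_half c J K hc)).
      apply (l2le_sum (V := V) (fun i => w (S J + i)%nat) (fun i => c / 2 ^ (S J + i))).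
      intros j _. apply hw.
Qed.

Definition vanish_off (D : Z -> Prop) u := forall n, ~ D n -> u n = zero.

(** The set D prescribes the support of data and solutions; taking D to be a
half-line expresses causality of the solution operator without mentioning it. *)
Definition solvable (D : Z -> Prop) T (M : R) : Prop :=
  forall g c, l2le g c -> vanish_off D g ->
  exists u, l2le u (M * c) /\ vanish_off D u /\ forall n, T u n = g n.

(** Operators act on all sequences; additivity and the bound are only asked on
square-summable ones, for which the defining series converge. *)
Record l2_operator (T : (Z -> V) -> Z -> V) (B : R) : Prop := {
  l2_op_bound : forall u c, l2le u c -> l2le (T u) (B * c);
  l2_op_plus : forall u v c d, l2le u c -> l2le v d ->
    forall n, T (fun k => plus (u k) (v k)) n = plus (T u n) (T v n);
  l2_op_opp : forall u c, l2le u c -> forall n, T (fun k => opp (u k)) n = opp (T u n)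
}.

Lemma l2_op_minus T B u v c d : l2_operator T B -> l2le u c -> l2le v d ->
  forall n, T (fun k => minus (u k) (v k)) n = minus (T u n) (T v n).
Proof.
  intros hT hu hv n. unfold minus.
  rewrite (l2_op_plus T B hT u (fun k => opp (v k)) c d hu ((l2le_opp (V := V)) _ _ hv)).
  by rewrite (l2_op_opp T B hT v d hv).
Qed.

Lemma lim_half_le0 x C : (forall J, x <= C / 2 ^ J) -> x <= 0.
Proof.
  intros h.
  apply (is_lim_seq_le (fun _ => x) (fun J => C / 2 ^ J) x 0); [easy|apply is_lim_seq_const|].
  apply (is_lim_seq_ext (fun J => C * (/ 2) ^ J)).
  - intros J. now rewrite -> pow_inv.
  - replace (Finite 0) with (Rbar_mult C 0) by (simpl; f_equal; ring).
    apply is_lim_seq_scal_l, is_lim_seq_geom. rewrite Rabs_pos_eq; lra.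
Qed.

(** Neumann series: with S0 solving T0 and E = T1 - T0, the terms
w_0 = S0 g, w_{i+1} = - S0 E w_i decay like 2^{-i}, and T1 applied to their
partial sums telescopes to g + E w_i. *)
Lemma solvable_perturb D T0 T1 M B d :
  0 <= M -> M * d <= / 2 -> 0 <= B -> 0 <= d ->
  l2_operator T1 B ->
  (forall u c, l2le u c -> l2le (fun n => minus (T1 u n) (T0 u n)) (d * c)) ->
  (forall u, vanish_off D u -> vanish_off D (fun n => minus (T1 u n) (T0 u n))) ->
  solvable D T0 M -> solvable D T1 (2 * M).
Proof.
  intros hM hMd hB hd hT1 hd1 hdD hS g c hg hgD.
  assert (hc : 0 <= c) by apply hg.
  pose (E := fun (u : Z -> V) n => minus (T1 u n) (T0 u n)).
  assert (hch : forall p : (Z -> V) * R, exists u,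
    l2le (fst p) (snd p) -> vanish_off D (fst p) ->
    l2le u (M * snd p) /\ vanish_off D u /\ forall n, T0 u n = fst p n).
  { intros [h b]; simpl. destruct (classic (l2le h b /\ vanish_off D h)) as [[h1 h2]|h1].
    - destruct (hS h b h1 h2) as [u hu]. now exists u.
    - exists h. tauto. }
  destruct (functional_choice _ hch) as [F hF]. clear hch.
  (* The bound is carried along with the data so that one choice function serves
     all the terms. *)
  pose (w := fix w (j : nat) : Z -> V := match j with
    | O => F (g, c)
    | S i => F (fun n => opp (E (w i) n), c / 2 ^ S i) end).
  assert (hE : forall u i, l2le u (M * (c / 2 ^ i)) -> l2le (E u) (c / 2 ^ S i)).
  { intros u i hu. eapply l2le_weaken; [|apply hd1, hu].
    simpl. replace (c / (2 * 2 ^ i)) with (/ 2 * (c / 2 ^ i))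
      by (field; apply pow_nonzero; lra).
    rewrite -Rmult_assoc. apply Rmult_le_compat_r; [|lra].
    apply Rdiv_le_0_compat; [easy|apply pow_lt; lra]. }
  assert (hw : forall j, l2le (w j) (M * (c / 2 ^ j)) /\ vanish_off D (w j)).
  { induction j as [|i [IH1 IH2]].
    - destruct (hF (g, c)) as (h1 & h2 & _); [easy|easy|]. simpl in h1.
      split; [|easy]. simpl. eapply l2le_weaken; [|exact h1]. right; field.
    - destruct (hF (fun n => opp (E (w i) n), c / 2 ^ S i)) as (h1 & h2 & _); simpl fst; simpl snd.
      + apply (l2le_opp (V := V)). now apply hE.
      + intros n hn. unfold E. by rewrite (hdD _ IH2 n hn) opp_zero.
      + split; [exact h1|exact h2]. }
  assert (hw0 : forall n, T0 (w 0%nat) n = g n).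
  { destruct (hF (g, c)) as (_ & _ & h); easy. }
  assert (hwS : forall i n, T0 (w (S i)) n = opp (E (w i) n)).
  { intros i. destruct (hF (fun n => opp (E (w i) n), c / 2 ^ S i)) as (_ & _ & h);
      simpl fst; simpl snd; [| |exact h].
    - apply (l2le_opp (V := V)), hE, hw.
    - intros n hn. unfold E. by rewrite (hdD _ (proj2 (hw i)) n hn) opp_zero. }
  destruct (l2_complete w (M * c)) as (u & hu0 & hu).
  { intros j. eapply l2le_weaken; [|apply hw]. right; field. apply pow_nonzero; lra. }
  pose (s := fun J n => sum_n (fun j => w j n) J).
  assert (hs : forall J, l2le (s J) (sum_n (fun j => M * (c / 2 ^ j)) J)).
  { intros J. apply (l2le_sum (V := V) w (fun j => M * (c / 2 ^ j))). intros; apply hw. }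
  assert (hu2 : l2le u (2 * M * c)).
  { eapply l2le_weaken; [|eapply l2le_ext;
      [|apply (l2le_plus (V := V)); [apply (hu 0%nat)|apply (hw 0%nat)]]].
    - simpl; right; field.
    - intros n. cbv beta; rewrite sum_O. by rewrite minus_plus_cancel. }
  exists u; split; [exact hu2|split].
  { intros n hn. apply hu0. intros j. now apply hw. }
  assert (ht : forall J n, T1 (s J) n = plus (g n) (E (w J) n)).
  { intros J; induction J as [|J IH]; intros n.
    - replace (s 0%nat) with (w 0%nat) by (extensionality k; unfold s; now rewrite sum_O).
      unfold E. rewrite hw0. unfold minus.
      by rewrite (plus_comm (T1 _ _)) plus_assoc plus_opp_r plus_zero_l.
    - replace (s (S J)) with (fun k => plus (s J k) (w (S J) k))
        by (extensionality k; unfold s; now rewrite sum_Sn).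
      rewrite (l2_op_plus T1 B hT1 _ _ _ _ (hs J) (proj1 (hw (S J)))) IH.
      rewrite -plus_assoc; f_equal.
      unfold E at 2. rewrite hwS. unfold minus. rewrite opp_opp. apply: plus_comm. }
  intros n.
  assert (hz : norm (minus (T1 u n) (g n)) <= 0).
  { apply (lim_half_le0 _ (B * (M * c) + c)). intros J.
    replace (minus (T1 u n) (g n)) with
      (plus (T1 (fun k => minus (u k) (s J k)) n) (E (w J) n)).
    - eapply Rle_trans; [apply (norm_triangle (V := V))|].
      replace ((B * (M * c) + c) / 2 ^ J) with (B * (M * c / 2 ^ J) + c / 2 ^ J)
        by (field; apply pow_nonzero; lra).
      apply Rplus_le_compat.
      + apply l2le_norm, (l2_op_bound T1 B hT1), hu.
      + apply (l2le_norm (V := V) (E (w J))). eapply l2le_weaken; [|apply hE, hw].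
        simpl. apply Rmult_le_compat_l; [easy|]. apply Rinv_le_contravar; [apply pow_lt; lra|].
        assert (0 < 2 ^ J) by (apply pow_lt; lra). lra.
    - rewrite (l2_op_minus T1 B _ _ _ _ hT1 hu2 (hs J)) ht. unfold minus.
      rewrite opp_plus -!plus_assoc plus_opp_l plus_zero_r. reflexivity. }
  assert (hz0 : minus (T1 u n) (g n) = zero).
  { apply (norm_eq_zero (V := V)). pose proof (norm_ge_0 (minus (T1 u n) (g n))).
    apply Rle_antisym; easy. }
  unfold minus in hz0. 
  transitivity (plus (plus (T1 u n) (opp (g n))) (g n)).
  - by rewrite -plus_assoc plus_opp_l plus_zero_r.
  - by rewrite hz0 plus_zero_l.
Qed.

(** The a priori bound is conditional on finite norm: it is what survives
perturbation, and it yields uniqueness. *)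
Definition coercive T (M : R) : Prop :=
  forall u c d, l2le u c -> l2le (T u) d -> l2le u (M * d).

(** Feeding a bound on u into the estimate for T0 halves the excess over
2 M |T1 u|, so iterating removes it. *)
Lemma coercive_perturb T0 T1 M d :
  0 <= M -> M * d <= / 2 -> 0 <= d ->
  (forall u c, l2le u c -> l2le (fun n => minus (T1 u n) (T0 u n)) (d * c)) ->
  coercive T0 M -> coercive T1 (2 * M).
Proof.
  intros hM hMd hd hE h0 u c b hu hb.
  assert (hc : 0 <= c) by apply hu. assert (hb' : 0 <= b) by apply hb.
  assert (k : forall j, l2le u (2 * M * b + c / 2 ^ j)).
  { induction j as [|j IH].
    - eapply l2le_weaken; [|exact hu]. simpl. pose proof (Rmult_le_pos _ _ hM hb'). lra.
    - eapply l2le_weaken; [|apply (h0 u _ (b + d * (2 * M * b + c / 2 ^ j)) IH)].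
      + rewrite Rmult_plus_distr_l -Rmult_assoc.
        assert (0 <= c / 2 ^ j) by (apply Rdiv_le_0_compat; [easy|apply pow_lt; lra]).
        pose proof (Rmult_le_pos _ _ hM hb').
        replace (c / 2 ^ S j) with (/ 2 * (c / 2 ^ j)) by (simpl; field; apply pow_nonzero; lra).
        apply Rle_trans with (M * b + / 2 * (2 * M * b + c / 2 ^ j)); [|lra].
        apply Rplus_le_compat_l, Rmult_le_compat_r; lra.
      + eapply l2le_ext; [|apply (l2le_minus (V := V)); [exact hb|apply hE, IH]].
        intros n. simpl. unfold minus.
        by rewrite opp_plus opp_opp plus_assoc plus_opp_r plus_zero_l. }
  apply l2le_closed. intros eps heps.
  destruct (pow_lt_1_zero (/ 2) ltac:(rewrite Rabs_pos_eq; lra) (eps / (c + 1))) as [N hN].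
  { apply Rdiv_lt_0_compat; lra. }
  specialize (hN N (le_n _)). rewrite Rabs_pos_eq in hN; [|apply pow_le; lra].
  eapply l2le_weaken; [|apply (k N)]. apply Rplus_le_compat_l.
  rewrite pow_inv in hN. unfold Rdiv.
  apply Rle_trans with (c * (eps / (c + 1))).
  - apply Rmult_le_compat_l; lra.
  - apply Rmult_le_reg_r with (c + 1); [lra|].
    replace (c * (eps / (c + 1)) * (c + 1)) with (c * eps) by (field; lra). nra.
Qed.
End Neumann.

(** * Roots of unity and Parseval's identity *)

Definition root_of_unity (N : nat) : C :=
  (cos (2 * PI / INR N), sin (2 * PI / INR N)).

Lemma cis_pow x n : Cpow (cos x, sin x) n = (cos (INR n * x), sin (INR n * x)).
Proof.
  induction n as [|n IH].
  - simpl. now rewrite Rmult_0_l cos_0 sin_0.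
  - rewrite Cpow_S IH S_INR Rmult_plus_distr_r Rmult_1_l cos_plus sin_plus.
    unfold Cmult; simpl. f_equal; ring.
Qed.

Lemma cis_conj_inv x n m : (n <= m)%nat ->
  (Cpow (cos x, sin x) m * Cconj (Cpow (cos x, sin x) n))%C = Cpow (cos x, sin x) (m - n).
Proof.
  intros h. rewrite !cis_pow minus_INR; [|easy].
  rewrite Rmult_minus_distr_r cos_minus sin_minus.
  unfold Cmult, Cconj; simpl. f_equal; ring.
Qed.

Lemma Cmod_cis x : Cmod (cos x, sin x) = 1.
Proof.
  unfold Cmod; cbn [fst snd].
  replace (cos x ^ 2 + sin x ^ 2) with 1; [apply sqrt_1|].
  pose proof (sin2_cos2 x) as e. unfold Rsqr in e. simpl. lra.
Qed.

(** By the double angle formula cos (2y) = 1 forces sin y = 0, impossible for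
0 < y < PI. *)
Lemma root_of_unity_pow N d : (0 < d < N)%nat -> Cpow (root_of_unity N) d <> RtoC 1.
Proof.
  intros [h1 h2]. unfold root_of_unity. rewrite cis_pow. intros e.
  assert (hc : cos (INR d * (2 * PI / INR N)) = 1) by exact (f_equal fst e).
  apply lt_INR in h1, h2. simpl in h1.
  pose proof PI_RGT_0.
  set (y := INR d * PI / INR N).
  replace (INR d * (2 * PI / INR N)) with (2 * y) in hc by (unfold y; field; lra).
  assert (hy : 0 < y < PI).
  { unfold y; split; [apply Rdiv_lt_0_compat; nra|].
    apply Rmult_lt_reg_r with (INR N); [lra|].
    replace (INR d * PI / INR N * INR N) with (INR d * PI) by (field; lra). nra. }
  rewrite cos_2a_sin in hc. pose proof (sin_gt_0 y ltac:(lra) ltac:(lra)). nra.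
Qed.

Lemma root_of_unity_pow_full N : Cpow (root_of_unity (S N)) (S N) = RtoC 1.
Proof.
  unfold root_of_unity. rewrite cis_pow.
  replace (INR (S N) * (2 * PI / INR (S N))) with (2 * PI)
    by (field; apply not_0_INR; lia).
  now rewrite cos_2PI sin_2PI.
Qed.

Lemma sum_n_geom (z : C) N :
  (sum_n (fun m => Cpow z m) N * (z - 1))%C = (Cpow z (S N) - 1)%C.
Proof.
  induction N as [|N IH].
  - rewrite sum_O. simpl. ring.
  - rewrite sum_Sn. change plus with Cplus.
    rewrite Cmult_plus_distr_r IH (Cpow_S _ (S N)). ring.
Qed.

Section Parseval.
Context {H : HilbertSpace}.

Lemma inner_sum_l (v : nat -> H) y N :
  inner H (sum_n v N) y = sum_n (fun j => inner H (v j) y) N.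
Proof.
  induction N as [|N IH]; [now rewrite !sum_O|].
  now rewrite !sum_Sn inner_plus_l IH.
Qed.

Lemma inner_plus_r (x y z : H) :
  inner H x (plus y z) = (inner H x y + inner H x z)%C.
Proof.
  rewrite inner_conj inner_plus_l Cplus_conj.
  now rewrite -(inner_conj H y x) -(inner_conj H z x).
Qed.

Lemma inner_scal_r c (x y : H) :
  inner H x (scal c y) = (Cconj c * inner H x y)%C.
Proof. by rewrite inner_conj inner_scal_l Cmult_conj -(inner_conj H y x). Qed.

Lemma inner_sum_r x (v : nat -> H) N :
  inner H x (sum_n v N) = sum_n (fun j => inner H x (v j)) N.
Proof.
  induction N as [|N IH]; [now rewrite !sum_O|].
  now rewrite !sum_Sn inner_plus_r IH.
Qed.

(** Expanding the square leaves sums over m of (w^{j-l})^m, which vanish for j <> l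
as geometric sums of a nontrivial root of unity. *)
Lemma parseval (v : nat -> H) N :
  sum_n (fun m => norm (sum_n (fun j => scal (Cpow (root_of_unity (S N)) (m * j)) (v j)) N) ^ 2) N
  = INR (S N) * sum_n (fun j => norm (v j) ^ 2) N.
Proof.
  apply RtoC_inj. set (w := root_of_unity (S N)).
  rewrite RtoC_mult !RtoC_sum_n.
  transitivity (sum_n (fun m => sum_n (fun j => sum_n (fun l =>
    (Cpow (Cpow w j * Cconj (Cpow w l)) m * inner H (v j) (v l))%C) N) N) N).
  { apply sum_n_ext; intros m. rewrite -inner_norm inner_sum_l.
    apply sum_n_ext; intros j. rewrite inner_sum_r.
    apply sum_n_ext; intros l. rewrite inner_scal_l inner_scal_r.
    rewrite Cpow_mult_l -Cpow_conj -!Cpow_mult_r.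
    rewrite (Nat.mul_comm m j) (Nat.mul_comm m l). cring. }
  rewrite (sum_n_switch (fun m j => sum_n (fun l =>
    (Cpow (Cpow w j * Cconj (Cpow w l)) m * inner H (v j) (v l))%C) N) N N).
  etransitivity; [|exact (sum_n_mult_l (K := C_Ring) _ _ N)].
  apply sum_n_ext_loc; intros j hj.
  rewrite (sum_n_switch (fun m l =>
    (Cpow (Cpow w j * Cconj (Cpow w l)) m * inner H (v j) (v l))%C) N N).
  rewrite -inner_norm.
  pose (b := fun l => if (l <=? N)%nat then
    (sum_n (fun m => Cpow (Cpow w j * Cconj (Cpow w l)) m) N * inner H (v j) (v l))%C
    else RtoC 0).
  rewrite (sum_n_ext_loc _ b); last first.
  { intros l hl. unfold b. rewrite (proj2 (Nat.leb_le l N) hl).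
    exact (sum_n_mult_r (K := C_Ring) _ _ N). }
  assert (hdiag : forall l, (Cpow w l * Cconj (Cpow w l))%C = RtoC 1).
  { intros l. unfold w, root_of_unity. rewrite cis_conj_inv; [|lia]. now rewrite Nat.sub_diag. }
  rewrite (sum_n_single b j N hj); last first.
  - intros l hl. unfold b. destruct (Nat.leb_spec l N) as [hlN|hlN]; [|easy].
    set (z := (Cpow w j * Cconj (Cpow w l))%C).
    assert (hz1 : z <> RtoC 1).
    { unfold z. destruct (Nat.lt_total j l) as [hjl|[hjl|hjl]]; [|lia|].
      - intros e. apply (root_of_unity_pow (S N) (l - j)); [lia|].
        unfold root_of_unity. rewrite -cis_conj_inv; [|lia].
        fold (root_of_unity (S N)). fold w.
        rewrite -(Cconj_conj (Cpow w l * Cconj (Cpow w j))).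
        rewrite Cmult_conj Cconj_conj Cmult_comm e. unfold Cconj, RtoC; simpl. f_equal; ring.
      - unfold w, root_of_unity. rewrite cis_conj_inv; [|lia].
        apply root_of_unity_pow; lia. }
    assert (hzN : Cpow z (S N) = RtoC 1).
    { unfold z. rewrite Cpow_mult_l -Cpow_conj -!Cpow_mult_r.
      rewrite (Nat.mul_comm j) (Nat.mul_comm l) !Cpow_mult_r.
      unfold w. rewrite root_of_unity_pow_full !Cpow_1_l.
      unfold Cmult, Cconj, RtoC; simpl. f_equal; ring. }
    assert (hs := sum_n_geom z N). rewrite hzN in hs.
    assert (hz0 : sum_n (fun m => Cpow z m) N = RtoC 0).
    { set (s := sum_n _ N) in *.
      replace s with ((s * (z - 1)) / (z - 1))%C.
      - rewrite hs. cfield. now apply Cminus_eq_contra.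
      - cfield. now apply Cminus_eq_contra. }
    rewrite hz0. apply Cmult_0_l.
  - unfold b. rewrite (proj2 (Nat.leb_le j N) hj).
    change (@mult C_Ring) with Cmult. f_equal.
    rewrite (sum_n_ext _ (fun _ => RtoC 1)); last first.
    + intros m. rewrite hdiag. apply Cpow_1_l.
    + rewrite -RtoC_sum_n. f_equal. rewrite sum_n_const. apply Rmult_1_r.
Qed.
End Parseval.

(** * Polynomial convolution operators *)

Lemma Cpow_lipschitz r (w z : C) k : Cmod w <= r -> Cmod z <= r ->
  Cmod (Cpow w (S k) - Cpow z (S k)) <= INR (S k) * r ^ k * Cmod (w - z).
Proof.
  intros hw hz. pose proof (Cmod_ge_0 w).
  induction k as [|k IH].
  - rewrite !Cpow_1_r. simpl. lra.
  - rewrite (Cpow_S w (S k)) (Cpow_S z (S k)).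
    replace (w * Cpow w (S k) - z * Cpow z (S k))%C with
      (w * (Cpow w (S k) - Cpow z (S k)) + (w - z) * Cpow z (S k))%C by ring.
    eapply Rle_trans; [apply Cmod_triangle|]. rewrite !Cmod_mult Cmod_pow.
    pose proof (Cmod_ge_0 (w - z)). pose proof (Cmod_ge_0 z).
    replace (INR (S (S k)) * r ^ S k * Cmod (w - z)) with
      (r * (INR (S k) * r ^ k * Cmod (w - z)) + Cmod (w - z) * r ^ S k)
      by (rewrite (S_INR (S k)); simpl; ring).
    apply Rplus_le_compat.
    + apply Rmult_le_compat; try easy. apply Cmod_ge_0.
    + apply Rmult_le_compat_l; [easy|].
      change (Cmod z ^ S k <= r ^ S k). now apply pow_incr.
Qed.

Lemma Cpow_lipschitz1 (w z : C) k : Cmod w <= 1 -> Cmod z <= 1 ->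
  Cmod (Cpow w k - Cpow z k) <= INR k * Cmod (w - z).
Proof.
  intros hw hz. destruct k as [|k].
  - simpl. replace (1 - 1)%C with (RtoC 0) by ring. rewrite Cmod_0. lra.
  - pose proof (Cpow_lipschitz 1 w z k hw hz) as h. now rewrite pow1 Rmult_1_r in h.
Qed.

Section Poly.
Context {H : HilbertSpace} (q : nat -> H -> H) (K : nat).
Hypothesis hq : forall k, is_linear (q k).

(** Convolution by the operators t^k q_k; the parameter t deforms it from the
identity (when q_0 is the identity) at t = 0. *)
Definition conv (t : C) (u : Z -> H) : Z -> H :=
  fun n => sum_n (fun k => scal (Cpow t k) (q k (u (n - Z.of_nat k)%Z))) K.

Definition poly_symbol (w : C) (x : H) : H :=
  sum_n (fun k => scal (Cpow w k) (q k x)) K.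

Lemma conv_bounds : exists b : nat -> R,
  (forall k, 0 <= b k) /\ forall k x, norm (q k x) <= b k * norm x.
Proof.
  destruct (functional_choice _ (fun k => linear_bound_nonneg (q k) (hq k))) as [b hb].
  exists b; split; intros; apply hb.
Qed.

Lemma l2le_conv_sum (b : nat -> R) (s : nat -> C) u c :
  (forall k, 0 <= b k) -> (forall k x, norm (q k x) <= b k * norm x) -> l2le u c ->
  l2le (fun n => sum_n (fun k => scal (s k) (q k (u (n - Z.of_nat k)%Z))) K)
    (sum_n (fun k => Cmod (s k) * b k) K * c).
Proof.
  intros hb hbq hu.
  rewrite -sum_n_Rmult_r.
  apply (l2le_sum (fun k n => scal (s k) (q k (u (n - Z.of_nat k)%Z)))
           (fun k => Cmod (s k) * b k * c)).
  intros k _. apply (l2le_map (fun n => u (n + - Z.of_nat k)%Z)).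
  - apply Rmult_le_pos; [apply Cmod_ge_0|easy].
  - intros n. eapply Rle_trans; [apply (norm_scal_C (V := H))|].
    rewrite Rmult_assoc. apply Rmult_le_compat_l; [apply Cmod_ge_0|apply hbq].
  - now apply l2le_shift.
Qed.

Lemma conv_operator t : Cmod t <= 1 -> exists B, 0 <= B /\ l2_operator (conv t) B.
Proof.
  intros ht. destruct conv_bounds as (b & hb & hbq).
  exists (sum_n (fun k => Cmod (Cpow t k) * b k) K); split; [|split].
  - induction K as [|k IH]; [rewrite sum_O|rewrite sum_Sn; apply Rplus_le_le_0_compat; [easy|]];
      (apply Rmult_le_pos; [apply Cmod_ge_0|easy]).
  - intros u c hu. now apply (l2le_conv_sum b (Cpow t)).
  - intros u v _ _ _ _ n. unfold conv. rewrite -sum_n_plus.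
    apply sum_n_ext; intros k. now rewrite (linear_plus _ (hq k)) scal_distr_l.
  - intros u _ _ n. unfold conv.
    transitivity (scal (opp one) (sum_n (fun k => scal (Cpow t k) (q k (u (n - Z.of_nat k)%Z))) K)).
    + rewrite -sum_n_scal_l. apply sum_n_ext; intros k.
      by rewrite (linear_map_opp _ (hq k)) scal_opp_one scal_opp_r.
    + by rewrite scal_opp_one.
Qed.

Lemma conv_diff : exists B, 0 <= B /\ forall t t' u c, Cmod t <= 1 -> Cmod t' <= 1 ->
  l2le u c -> l2le (fun n => minus (conv t' u n) (conv t u n)) (Cmod (t' - t) * B * c).
Proof.
  destruct conv_bounds as (b & hb & hbq).
  exists (sum_n (fun k => INR k * b k) K); split.
  - induction K as [|k IH]; [rewrite sum_O|rewrite sum_Sn; apply Rplus_le_le_0_compat; [easy|]];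
      (apply Rmult_le_pos; [apply pos_INR|easy]).
  - intros t t' u c ht ht' hu. assert (hc : 0 <= c) by apply hu.
    apply (l2le_weaken _ (sum_n (fun k => Cmod (Cpow t' k - Cpow t k) * b k) K * c)).
    + apply Rmult_le_compat_r; [easy|].
      rewrite -sum_n_Rmult_l.
      apply sum_n_m_le; intros k.
      replace (Cmod (t' - t) * (INR k * b k)) with (INR k * Cmod (t' - t) * b k) by ring.
      apply Rmult_le_compat_r; [easy|]. now apply Cpow_lipschitz1.
    + eapply l2le_ext; [|apply (l2le_conv_sum b (fun k => Cpow t' k - Cpow t k)%C u c hb hbq hu)].
      intros n. unfold conv, minus.
      rewrite -[X in plus _ X]scal_opp_one -sum_n_scal_l -sum_n_plus.
      apply sum_n_ext; intros k.
      rewrite scal_opp_one -scal_opp_l -scal_distr_r. reflexivity.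
Qed.

Lemma conv_vanish_off (D : Z -> Prop) t u :
  (forall n k, D (n - Z.of_nat k)%Z -> D n) -> vanish_off D u -> vanish_off D (conv t u).
Proof.
  intros hD hu n hn. unfold conv. generalize K as m.
  assert (e : forall k, scal (Cpow t k) (q k (u (n - Z.of_nat k)%Z)) = zero).
  { intros k. rewrite hu; [|intros h; apply hn; eapply hD, h].
    by rewrite (linear_map_zero _ (hq k)) scal_zero_r. }
  induction m as [|m IH]; [by rewrite sum_O|].
  by rewrite sum_Sn IH e plus_zero_l.
Qed.

Lemma conv_zero u n : (forall x, q 0%nat x = x) -> conv (RtoC 0) u n = u n.
Proof.
  intros h0. unfold conv.
  rewrite (sum_n_single _ 0%nat); [|lia|].
  2:{ intros [|l] hl; [easy|]. rewrite Cpow_S Cmult_0_l. exact (scal_zero_l _). }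
  rewrite h0. replace (n - Z.of_nat 0)%Z with n by lia. exact (scal_one _).
Qed.

(** The discrete Fourier transform at z turns the convolution into multiplication by
the symbol at t z. The range K + N leaves room for the spreading of the support. *)
Lemma fourier_conv t z u a N :
  (forall n, ~ (a <= n <= a + Z.of_nat N)%Z -> u n = zero) ->
  sum_n (fun j => scal (Cpow z j) (conv t u (a + Z.of_nat j)%Z)) (K + N) =
  poly_symbol (t * z)%C (sum_n (fun j => scal (Cpow z j) (u (a + Z.of_nat j)%Z)) (K + N)).
Proof.
  intros hu. unfold poly_symbol, conv.
  rewrite (sum_n_ext _ (fun j => sum_n (fun k =>
     scal (Cpow z j) (scal (Cpow t k) (q k (u (a + Z.of_nat j - Z.of_nat k)%Z)))) K));
    [|intros j; now rewrite sum_n_scal_l].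
  rewrite sum_n_switch. apply sum_n_ext_loc; intros k hk.
  rewrite (linear_sum_n _ (hq k)) -sum_n_scal_l.
  replace (K + N)%nat with (k + (K - k + N))%nat by lia.
  apply sum_n_delay.
  - intros j hj. rewrite hu; [|lia]. by rewrite (linear_map_zero _ (hq k)) !scal_zero_r.
  - intros j. replace (a + Z.of_nat (k + j) - Z.of_nat k)%Z with (a + Z.of_nat j)%Z by lia.
    rewrite (linear_scal _ (hq k)) !(scal_Cmult (V := H)). f_equal.
    rewrite Cpow_mult_l Cpow_add_r. cring.
  - intros j hj. rewrite hu; [|lia].
    by rewrite scal_zero_r (linear_map_zero _ (hq k)) !scal_zero_r.
Qed.

Variables (r M : R).
Hypothesis hr : 0 <= r <= 1.
Hypothesis hM : 0 <= M.
Hypothesis hsymbol : forall w x, Cmod w <= r -> norm x <= M * norm (poly_symbol w x).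

(** Parseval with as many nodes as the output window has entries: the norms of input and
output become averages over the nodes, where the symbol bound applies. *)
Lemma conv_coercive_finite t u a N c : Cmod t <= r ->
  (forall n, ~ (a <= n <= a + Z.of_nat N)%Z -> u n = zero) ->
  l2le (conv t u) c -> l2le u (M * c).
Proof.
  intros ht hu [hc hv]. split; [nra|]. intros b L.
  assert (hpos : forall n, 0 <= norm (u n) ^ 2) by (intros; apply pow2_ge_0).
  eapply Rle_trans; [apply (window_sum_supp _ a (S (K + N))); [easy|]|].
  { intros n hn. rewrite hu; [|lia]. rewrite norm_zero. ring. }
  rewrite Rpow_mult_distr.
  apply Rle_trans with (M ^ 2 * window_sum (fun n => norm (conv t u n) ^ 2) a (S (K + N))).
  2:{ apply Rmult_le_compat_l; [apply pow2_ge_0|apply hv]. }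
  rewrite !window_sum_sum_n.
  apply Rmult_le_reg_l with (INR (S (K + N))); [apply lt_0_INR; lia|].
  rewrite -Rmult_assoc (Rmult_comm _ (M ^ 2)) Rmult_assoc.
  rewrite -(parseval (fun j => u (a + Z.of_nat j)%Z)).
  rewrite -(parseval (fun j => conv t u (a + Z.of_nat j)%Z)).
  rewrite -sum_n_Rmult_l.
  apply sum_n_m_le; intros m.
  set (z := root_of_unity (S (K + N))).
  assert (hz : forall y : nat -> H, sum_n (fun j => scal (Cpow z (m * j)) (y j)) (K + N) =
    sum_n (fun j => scal (Cpow (Cpow z m) j) (y j)) (K + N)).
  { intros y. apply sum_n_ext; intros j. now rewrite Cpow_mult_r. }
  rewrite (hz (fun j => u (a + Z.of_nat j)%Z)) (hz (fun j => conv t u (a + Z.of_nat j)%Z)).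
  rewrite fourier_conv; [|easy].
  rewrite -Rpow_mult_distr.
  apply pow_incr; split; [apply norm_ge_0|]. apply hsymbol.
  rewrite Cmod_mult Cmod_pow.
  replace (Cmod z) with 1; [now rewrite pow1 Rmult_1_r|].
  symmetry; apply Cmod_cis.
Qed.

(** Truncations of u are finitely supported and converge to u in norm, and the
convolution is bounded. *)
Lemma conv_coercive t : Cmod t <= r -> coercive (conv t) M.
Proof.
  intros ht u c d hu hd.
  destruct (conv_operator t) as (B & hB & hT); [lra|].
  apply l2le_closed. intros eps heps.
  (* Truncating u changes the output by at most B e, so the error is
     M B e + e = eps. *)
  set (e := eps / (M * B + 1)).
  assert (hMB : 0 <= M * B) by now apply Rmult_le_pos.
  assert (he : 0 < e) by (apply Rdiv_lt_0_compat; lra).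
  destruct (l2le_tail u c e hu he) as [N hN].
  assert (h1 : l2le (conv t (trunc N u)) (d + B * e)).
  { eapply l2le_ext; [|apply (l2le_minus (V := H)); [exact hd|apply (l2_op_bound _ _ hT _ _ hN)]].
    intros n; cbv beta. rewrite (l2_op_minus _ _ _ _ _ _ hT hu (l2le_trunc N u c hu)).
    unfold minus. by rewrite opp_plus opp_opp plus_assoc plus_opp_r plus_zero_l. }
  assert (h2 : l2le (trunc N u) (M * (d + B * e))).
  { apply (conv_coercive_finite t _ (- Z.of_nat N) (2 * N) _ ht); [|easy].
    intros n hn. unfold trunc. destruct (Z.leb_spec (Z.abs n) (Z.of_nat N)); [lia|easy]. }
  eapply l2le_weaken; [|eapply l2le_ext; [|apply (l2le_plus (V := H) _ _ _ _ hN h2)]].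
  - right. unfold e. field. lra.
  - intros n; cbv beta. by rewrite minus_plus_cancel.
Qed.

Lemma solvable_coercive (T : (Z -> H) -> Z -> H) D M' :
  coercive T M -> solvable D T M' -> solvable D T M.
Proof.
  intros hc hs g c hg hD. destruct (hs g c hg hD) as (u & h1 & h2 & h3).
  exists u; split; [|easy]. apply (hc u _ c h1). now apply (l2le_ext g).
Qed.

(** Continuity method: the a priori bound has the same constant for all parameters,
so each Neumann step has the same admissible length and r is reached after
finitely many of them. *)
Lemma conv_solvable (D : Z -> Prop) : 1 <= M -> (forall x, q 0%nat x = x) ->
  (forall n k, D (n - Z.of_nat k)%Z -> D n) -> solvable D (conv (RtoC r)) M.
Proof.
  intros hM1 h0 hD.
  destruct conv_diff as (B & hB & hdiff).
  (* Steps of length r / m change the operator by at most B / m in norm, which must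
     not exceed 1 / (2 M). *)
  destruct (INR_unbounded (2 * (M * B))) as [m0 hm0].
  pose (m := S m0).
  assert (hm : 0 < INR m) by (apply lt_0_INR; unfold m; lia).
  assert (hm2 : 2 * (M * B) < INR m) by (unfold m; rewrite S_INR; lra).
  pose (t := fun i : nat => r * (INR i / INR m)).
  assert (ht : forall i, (i <= m)%nat -> Cmod (RtoC (t i)) <= r).
  { intros i hi. apply le_INR in hi. pose proof (pos_INR i).
    assert (0 <= INR i / INR m <= 1).
    { split; [now apply Rdiv_le_0_compat|].
      apply Rmult_le_reg_r with (INR m); [easy|]. unfold Rdiv. rewrite Rmult_assoc Rinv_l; lra. }
    rewrite Cmod_R Rabs_pos_eq; unfold t; nra. }
  replace r with (t m) by (unfold t; field; lra).
  assert (hmain : forall i, (i <= m)%nat -> solvable D (conv (RtoC (t i))) M);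
    [|now apply hmain].
  induction i as [|i IH]; intros hi.
  - intros g c hg hgD. exists g. split; [|split; [easy|]].
    + eapply l2le_weaken; [|exact hg]. destruct hg as [hc _]. nra.
    + intros n. replace (t 0%nat) with 0 by (unfold t; change (INR 0) with 0; field; lra).
      now apply conv_zero.
  - destruct (conv_operator (RtoC (t (S i)))) as (B1 & hB1 & hT1).
    { eapply Rle_trans; [apply ht|]; [easy|lra]. }
    apply (solvable_coercive _ _ (2 * M)); [now apply conv_coercive, ht|].
    apply (solvable_perturb D (conv (RtoC (t i))) _ M B1 (r / INR m * B)); try easy.
    + apply Rle_trans with (M * B / INR m).
      * replace (M * (r / INR m * B)) with (M * B / INR m * r) by (field; lra).
        rewrite -{2}(Rmult_1_r (M * B / INR m)). apply Rmult_le_compat_l; [|easy].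
        apply Rdiv_le_0_compat; [now apply Rmult_le_pos|easy].
      * apply Rmult_le_reg_r with (INR m); [easy|].
        replace (M * B / INR m * INR m) with (M * B) by (field; lra). lra.
    + apply Rmult_le_pos; [apply Rdiv_le_0_compat; lra|easy].
    + intros u c hu.
      replace (r / INR m) with (Cmod (RtoC (t (S i)) - RtoC (t i))).
      * apply hdiff; [| |easy]; (eapply Rle_trans; [apply ht|]; [lia|lra]).
      * rewrite -RtoC_minus Cmod_R. unfold t.
        replace (r * (INR (S i) / INR m) - r * (INR i / INR m)) with (r / INR m)
          by (rewrite S_INR; field; lra).
        apply Rabs_pos_eq, Rdiv_le_0_compat; lra.
    + intros u hu n hn. rewrite !(conv_vanish_off D); try easy.
      by rewrite minus_eq_zero.
    + apply IH; lia.
Qed.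
End Poly.

(** * The binomial series *)

(** Convergence is restated through the norm because the complex numbers carry two
uniform structures, one as an absolute ring and one as a normed module. *)
Lemma is_series_norm {V : NormedModule C_AbsRing} (a : nat -> V) l :
  is_series a l <->
  forall eps, 0 < eps -> exists N, forall n, (N <= n)%nat -> norm (minus (sum_n a n) l) < eps.
Proof.
  split.
  - intros h eps heps.
    destruct (proj1 (filterlim_locally_ball_norm (sum_n a) l) h (mkposreal eps heps)) as [N hN].
    now exists N.
  - intros h. apply (filterlim_locally_ball_norm (sum_n a) l). intros eps.
    destruct (h eps (cond_pos eps)) as [N hN]. now exists N.
Qed.

Lemma is_series_scal_vector {V : NormedModule C_AbsRing} (a : nat -> C) (l : C) (y : V) :
  is_series (V := C_NormedModule) a l -> is_series (fun k => scal (a k) y) (scal l y).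
Proof.
  intros h. apply is_series_norm. intros eps heps.
  pose proof (norm_ge_0 y).
  destruct (proj1 (is_series_norm a l) h (eps / (norm y + 1))) as [N hN].
  { apply Rdiv_lt_0_compat; lra. }
  exists N. intros n hn. specialize (hN n hn).
  assert (e : sum_n (fun k => scal (a k) y) n = scal (sum_n a n) y).
  { clear. induction n as [|n IH]; [now rewrite !sum_O|].
    rewrite !sum_Sn IH. symmetry. exact (scal_distr_r _ _ _). }
  rewrite e.
  match goal with |- norm ?x < _ =>
    replace x with (scal (minus (sum_n a n) l) y) by exact (scal_minus_distr_r _ _ _) end.
  apply Rle_lt_trans with (Cmod (minus (sum_n a n) l) * norm y); [exact (norm_scal_C _ _)|].
  change (norm (minus (sum_n a n) l)) with (Cmod (minus (sum_n a n) l)) in hN.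
  set (z := Cmod _) in *. assert (0 <= z) by apply Cmod_ge_0.
  apply Rle_lt_trans with (z * (norm y + 1)); [nra|].
  apply Rmult_lt_compat_r with (r := norm y + 1) in hN; [|lra].
  replace (eps / (norm y + 1) * (norm y + 1)) with eps in hN by (field; lra). lra.
Qed.

Definition diff_coef (alpha : C) (k : nat) : C := (Cpow (RtoC (-1)) k * binom alpha k)%C.

(** The function (1 - w)^alpha of w = 1/z. *)
Definition diff_symbol (alpha w : C) : C :=
  VSeries (V := C_CompleteNormedModule) (fun k => (diff_coef alpha k * Cpow w k)%C).

Lemma f_frac_symbol alpha z : f_frac alpha z = (z * diff_symbol alpha (/ z))%C.
Proof.
  unfold f_frac, one_plus_pow, diff_symbol. do 3 f_equal.
  extensionality k. unfold diff_coef.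
  replace (- / z)%C with (RtoC (-1) * / z)%C.
  - rewrite Cpow_mult_l. ring.
  - replace (RtoC (-1)) with (- RtoC 1)%C; [ring|].
    rewrite -RtoC_opp. f_equal; ring.
Qed.

Lemma diff_coef_0 alpha : diff_coef alpha 0 = RtoC 1.
Proof. unfold diff_coef, binom; simpl. field. Qed.

Lemma diff_coef_le alpha k : 0 < alpha < 1 -> Cmod (diff_coef (RtoC alpha) k) <= 1.
Proof.
  intros h. unfold diff_coef, binom.
  assert (hf : Cmod (falling_factorial (RtoC alpha) k) <= INR (fact k)).
  { induction k as [|k IH].
    - simpl. rewrite Cmod_1. lra.
    - cbn [falling_factorial]. rewrite Cmod_mult -RtoC_minus Cmod_R.
      rewrite fact_simpl mult_INR (Rmult_comm (INR (S k))).
      apply Rmult_le_compat; try easy; [apply Cmod_ge_0|apply Rabs_pos|].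
      rewrite S_INR. pose proof (pos_INR k). apply Rabs_le. lra. }
  pose proof (INR_fact_lt_0 k).
  rewrite Cmod_mult Cmod_pow Cmod_R Rabs_Ropp Rabs_R1 pow1 Rmult_1_l.
  rewrite Cmod_div; [|intros e; apply RtoC_inj in e; lra].
  rewrite Cmod_R (Rabs_pos_eq (INR _)); [|lra].
  apply Rmult_le_reg_r with (INR (fact k)); [easy|].
  unfold Rdiv. rewrite Rmult_assoc Rinv_l; lra.
Qed.

Lemma sum_n_geom_le r m n : 0 <= r < 1 ->
  sum_n (fun k => r ^ (m + k)) n <= r ^ m / (1 - r).
Proof.
  intros hr.
  assert (e : sum_n (fun k => r ^ (m + k)) n = (r ^ m - r ^ (m + S n)) / (1 - r)).
  { induction n as [|n IH].
    - rewrite sum_O Nat.add_0_r Nat.add_1_r. simpl. field; lra.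
    - rewrite sum_Sn IH. unfold plus; simpl.
      replace (m + S (S n))%nat with (S (m + S n)) by lia. simpl. field; lra. }
  rewrite e. apply Rmult_le_compat_r; [left; apply Rinv_0_lt_compat; lra|].
  assert (0 <= r ^ (m + S n)) by (apply pow_le; lra). lra.
Qed.

(** The partial sums have the closed form
(1 - (n+1) r^n + n r^{n+1}) / (1 - r)^2. *)
Lemma sum_n_geom_deriv_le r n : 0 <= r < 1 ->
  sum_n (fun k => INR k * r ^ pred k) n <= / (1 - r) ^ 2.
Proof.
  intros hr.
  assert (e : sum_n (fun k => INR k * r ^ pred k) n =
    (1 - INR (S n) * r ^ n + INR n * r ^ S n) / (1 - r) ^ 2).
  { induction n as [|n IH].
    - rewrite sum_O. simpl. field; lra.
    - rewrite sum_Sn IH. change (@plus R_AbelianMonoid) with Rplus. rewrite !S_INR.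
      change (pred (S n)) with n. cbn [pow]. generalize (r ^ n) (INR n). intros x y.
      match goal with |- @eq _ ?a ?b => change (@eq R a b) end. field; lra. }
  rewrite e. unfold Rdiv. rewrite -{2}(Rmult_1_l (/ _)).
  apply Rmult_le_compat_r; [left; apply Rinv_0_lt_compat, pow_lt; lra|].
  rewrite S_INR. cbn [pow]. pose proof (pos_INR n).
  assert (0 <= r ^ n) by (apply pow_le; lra).
  assert (0 <= INR n * r ^ n * (1 - r)) by (apply Rmult_le_pos; [apply Rmult_le_pos; lra|lra]).
  lra.
Qed.

Section Symbol.
Variables (alpha r : R).
Hypothesis halpha : 0 < alpha < 1.
Hypothesis hr : 0 <= r < 1.
Let a := diff_coef (RtoC alpha).
Let g := diff_symbol (RtoC alpha).

Lemma ex_series_geom_bound {V : CompleteNormedModule C_AbsRing} (y : nat -> V) c :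
  (forall k, norm (y k) <= c * r ^ k) -> ex_series y.
Proof.
  intros h. apply (ex_series_le (K := C_AbsRing) (V := V) _ (fun k => c * r ^ k)); [easy|].
  apply (ex_series_scal_l (K := R_AbsRing) (V := R_NormedModule) c (fun k => r ^ k)).
  exists (/ (1 - r)). apply is_series_geom. rewrite Rabs_pos_eq; lra.
Qed.

Lemma diff_symbol_term_le w k : Cmod w <= r -> Cmod (a k * Cpow w k) <= r ^ k.
Proof.
  intros hw. rewrite Cmod_mult Cmod_pow. rewrite -(Rmult_1_l (r ^ k)).
  apply Rmult_le_compat; [apply Cmod_ge_0|apply pow_le, Cmod_ge_0| |].
  - now apply diff_coef_le.
  - apply pow_incr; split; [apply Cmod_ge_0|easy].
Qed.

Lemma is_series_diff_symbol w : Cmod w <= r ->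
  is_series (V := C_NormedModule) (fun k => (a k * Cpow w k)%C) (g w).
Proof.
  intros hw. apply (VSeries_correct (V := C_CompleteNormedModule)).
  apply (ex_series_geom_bound (V := C_CompleteNormedModule) _ 1).
  intros k. rewrite Rmult_1_l. exact (diff_symbol_term_le w k hw).
Qed.

(** Termwise, with the derivative of the geometric series as majorant. *)
Lemma diff_symbol_lipschitz w z : Cmod w <= r -> Cmod z <= r ->
  Cmod (g w - g z) <= / (1 - r) ^ 2 * Cmod (w - z).
Proof.
  intros hw hz.
  assert (hs := is_series_minus (K := C_AbsRing) (V := C_NormedModule) _ _ _ _
    (is_series_diff_symbol w hw) (is_series_diff_symbol z hz)).
  apply (norm_series_le (V := C_CompleteNormedModule) _ _ _ hs).
  intros n. eapply Rle_trans.
  { apply (norm_sum_n_le (V := C_CompleteNormedModule) _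
      (fun k => INR k * r ^ pred k * Cmod (w - z))).
    intros k. change (Cmod (a k * Cpow w k - a k * Cpow z k) <= INR k * r ^ pred k * Cmod (w - z)).
    replace (a k * Cpow w k - a k * Cpow z k)%C with (a k * (Cpow w k - Cpow z k))%C by ring.
    rewrite Cmod_mult.
    apply Rle_trans with (1 * Cmod (Cpow w k - Cpow z k)).
    - apply Rmult_le_compat_r; [apply Cmod_ge_0|now apply diff_coef_le].
    - rewrite Rmult_1_l. destruct k as [|k].
      + simpl. replace (1 - 1)%C with (RtoC 0) by ring. rewrite Cmod_0. lra.
      + simpl pred. now apply Cpow_lipschitz. }
  rewrite sum_n_Rmult_r. apply Rmult_le_compat_r; [apply Cmod_ge_0|].
  now apply sum_n_geom_deriv_le.
Qed.

Lemma is_series_tail {V : CompleteNormedModule C_AbsRing} (y : nat -> V) l K :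
  is_series y l -> is_series (fun k => y (S K + k)%nat) (minus l (sum_n y K)).
Proof.
  intros h. refine (is_series_incr_n y (S K) _ _ _); [lia|].
  replace (plus _ _) with l; [easy|].
  simpl pred. by rewrite minus_plus_cancel.
Qed.

Lemma diff_symbol_tail w K : Cmod w <= r ->
  Cmod (g w - sum_n (fun k => (a k * Cpow w k)%C) K) <= r ^ S K / (1 - r).
Proof.
  intros hw.
  assert (hs := is_series_tail (V := C_CompleteNormedModule) _ _ K (is_series_diff_symbol w hw)).
  apply (norm_series_le (V := C_CompleteNormedModule) _ _ _ hs).
  intros n. eapply Rle_trans; [|apply (sum_n_geom_le r (S K) n hr)].
  apply (norm_sum_n_le (V := C_CompleteNormedModule)).
  intros k. exact (diff_symbol_term_le w _ hw).
Qed.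
End Symbol.

(** * The pencil and its convolution operator *)

Section Full.
Context {H : HilbertSpace} (A : H -> H) (alpha r : R).
Hypothesis hA : is_linear A.
Hypothesis halpha : 0 < alpha < 1.
Hypothesis hr : 0 <= r < 1.
Notation a := (diff_coef (RtoC alpha)).
Notation g := (diff_symbol (RtoC alpha)).
Implicit Types (u v : Z -> H) (x : H) (w z : C).

(** The symbol P(w) = (1 - w)^alpha - w A. It equals w (f(1/w) - A) for w <> 0 and
the identity for w = 0, so it has no singularity on the disc. *)
Definition pencil (w : C) (x : H) : H := minus (scal (g w) x) (scal w (A x)).

Definition pencil_coef (k : nat) (x : H) : H :=
  minus (scal (a k) x) (if (k =? 1)%nat then A x else zero).

(** The convolution with symbol P(r w), in which the weights of the sequence space
have been absorbed into the factors r^k. *)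
Definition pencil_op (u : Z -> H) : Z -> H := fun n =>
  minus (VSeries (fun k => scal (a k * Cpow (RtoC r) k)%C (u (n - Z.of_nat k)%Z)))
    (scal (RtoC r) (A (u (n - 1)%Z))).

Lemma pencil_coef_linear k : is_linear (pencil_coef k).
Proof.
  assert (hs : is_linear (fun x : H => scal (a k) x)).
  { apply (is_linear_scal_r (K := C_AbsRing) (V := H)). intros n m; apply Cmult_comm. }
  unfold pencil_coef, minus.
  destruct (Nat.eqb k 1).
  - apply (is_linear_comp (fun x : H => (scal (a k) x, opp (A x))) (fun p => plus (fst p) (snd p))).
    + apply (is_linear_prod (T := H) (fun x => scal (a k) x) (fun x => opp (A x))); [easy|].
      apply (is_linear_comp A opp); [easy|apply is_linear_opp].
    + apply is_linear_plus.
  - split.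
    + intros x y. rewrite (linear_plus _ hs). by rewrite opp_zero !plus_zero_r.
    + intros c x. rewrite (linear_scal _ hs). by rewrite opp_zero !plus_zero_r.
    + destruct (linear_norm _ hs) as (m & hm & h). exists m; split; [easy|].
      intros x. rewrite opp_zero plus_zero_r. apply h.
Qed.

Lemma pencil_coef_0 x : pencil_coef 0 x = x.
Proof.
  unfold pencil_coef; simpl. rewrite diff_coef_0 minus_zero_r. exact (scal_one x).
Qed.

Lemma sum_pencil_coef w (y : nat -> H) K : (1 <= K)%nat ->
  sum_n (fun k => scal (Cpow w k) (pencil_coef k (y k))) K =
  minus (sum_n (fun k => scal (a k * Cpow w k)%C (y k)) K) (scal w (A (y 1%nat))).
Proof.
  intros hK.
  pose (b := fun k => scal (Cpow w k) (opp (if (k =? 1)%nat then A (y k) else zero))).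
  rewrite (sum_n_ext _ (fun k => plus (scal (a k * Cpow w k)%C (y k)) (b k))).
  - rewrite sum_n_plus. unfold minus. f_equal.
    rewrite (sum_n_single b 1); [|easy|].
    + unfold b; simpl. by rewrite Cmult_1_r scal_opp_r.
    + intros l hl. unfold b. destruct (Nat.eqb_spec l 1); [lia|].
      by rewrite opp_zero scal_zero_r.
  - intros k. unfold pencil_coef, b, minus. rewrite scal_distr_l. f_equal.
    rewrite (scal_Cmult (V := H)). by rewrite Cmult_comm.
Qed.

Lemma pencil_term_le u c n k : l2le u c ->
  norm (scal (a k * Cpow (RtoC r) k)%C (u (n - Z.of_nat k)%Z)) <= c * r ^ k.
Proof.
  intros hu. eapply Rle_trans; [apply (norm_scal_C (V := H))|].
  rewrite Rmult_comm. apply Rmult_le_compat; [apply norm_ge_0|apply Cmod_ge_0| |].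
  - now apply l2le_norm.
  - apply diff_symbol_term_le; [easy|]. rewrite Cmod_R Rabs_pos_eq; lra.
Qed.

Lemma pencil_series u c n : l2le u c ->
  is_series (fun k => scal (a k * Cpow (RtoC r) k)%C (u (n - Z.of_nat k)%Z))
    (VSeries (fun k => scal (a k * Cpow (RtoC r) k)%C (u (n - Z.of_nat k)%Z))).
Proof.
  intros hu. apply VSeries_correct.
  apply (ex_series_geom_bound r hr _ c). intros k. now apply pencil_term_le.
Qed.

(** Young inequality for the tail: its coefficients sum to at most
r^{K+1} / (1 - r). *)
Lemma pencil_op_diff u c K : (1 <= K)%nat -> l2le u c ->
  l2le (fun n => minus (pencil_op u n) (conv pencil_coef K (RtoC r) u n))
    (r ^ S K / (1 - r) * c).
Proof.
  intros hK hu. assert (hc : 0 <= c) by apply hu.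
  pose (y := fun n k => scal (a k * Cpow (RtoC r) k)%C (u (n - Z.of_nat k)%Z)).
  apply (l2le_ext (fun n => minus (VSeries (y n)) (sum_n (y n) K))).
  { intros n. unfold pencil_op, conv.
    rewrite (sum_pencil_coef (RtoC r) (fun k => u (n - Z.of_nat k)%Z) K hK).
    change (n - Z.of_nat 1)%Z with (n - 1)%Z. fold (y n).
    by rewrite minus_cancel_r. }
  apply (l2le_lim (fun J n => sum_n (fun k => y n (S K + k)%nat) J)).
  - intros n. exact (is_series_tail _ _ K (pencil_series u c n hu)).
  - intros J.
    apply (l2le_weaken _ (sum_n (fun k => r ^ (S K + k) * c) J)).
    { rewrite sum_n_Rmult_r. apply Rmult_le_compat_r; [easy|]. now apply sum_n_geom_le. }
    apply (l2le_sum (V := H) (fun k n => y n (S K + k)%nat) (fun k => r ^ (S K + k) * c)).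
    intros k _. apply (l2le_map (fun n => u (n + - Z.of_nat (S K + k))%Z)).
    + apply pow_le; lra.
    + intros n. eapply Rle_trans; [apply (norm_scal_C (V := H))|].
      apply Rmult_le_compat_r; [apply norm_ge_0|].
      apply diff_symbol_term_le; [easy|]. rewrite Cmod_R Rabs_pos_eq; lra.
    + now apply l2le_shift.
Qed.

Lemma pencil_op_operator : exists B, 0 <= B /\ l2_operator pencil_op B.
Proof.
  destruct (conv_operator pencil_coef 1 pencil_coef_linear (RtoC r)) as (B & hB & hT).
  { rewrite Cmod_R Rabs_pos_eq; lra. }
  assert (hp : 0 <= r ^ 2 / (1 - r)).
  { apply Rdiv_le_0_compat; [apply pow2_ge_0|lra]. }
  exists (r ^ 2 / (1 - r) + B); split; [lra|]. split.
  - intros u c hu.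
    eapply l2le_ext; [|eapply l2le_weaken; [|apply (l2le_plus (V := H));
      [apply (pencil_op_diff u c 1 (le_n _) hu)|apply (l2_op_bound _ _ hT u c hu)]]].
    + intros n; cbv beta. by rewrite minus_plus_cancel.
    + right; ring.
  - intros u v c d hu hv n. unfold pencil_op.
    rewrite (VSeries_unique _ _ (is_series_ext _ _ _ _
      (is_series_plus _ _ _ _ (pencil_series u c n hu) (pencil_series v d n hv)))); last first.
    { intros k. by rewrite scal_distr_l. }
    rewrite (linear_plus _ hA) scal_distr_l. apply: minus_plus_plus.
  - intros u c hu n. unfold pencil_op.
    rewrite (VSeries_unique _ _ (is_series_ext _ _ _ _
      (is_series_opp _ _ (pencil_series u c n hu)))); last first.
    { intros k. by rewrite scal_opp_r. }
    rewrite (linear_map_opp _ hA) scal_opp_r. unfold minus. by rewrite opp_plus.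
Qed.

Lemma pencil_op_vanish_off (D : Z -> Prop) u :
  (forall n k, D (n - Z.of_nat k)%Z -> D n) -> vanish_off D u -> vanish_off D (pencil_op u).
Proof.
  intros hD hu n hn. unfold pencil_op.
  assert (e : forall k, u (n - Z.of_nat k)%Z = zero).
  { intros k. apply hu. intros h; apply hn; eapply hD, h. }
  change (n - 1)%Z with (n - Z.of_nat 1)%Z.
  rewrite e (linear_map_zero _ hA) scal_zero_r minus_zero_r.
  apply VSeries_unique.
  apply (is_series_ext (fun _ => zero)); [intros j; by rewrite e scal_zero_r|].
  apply (filterlim_ext (fun _ => zero)); [|apply filterlim_const].
  intros N; induction N as [|N IH]; [now rewrite sum_O|].
  by rewrite sum_Sn -IH plus_zero_l.
Qed.

Lemma pencil_lipschitz : exists L, 0 <= L /\ forall w z x, Cmod w <= r -> Cmod z <= r ->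
  norm (minus (pencil w x) (pencil z x)) <= L * Cmod (w - z) * norm x.
Proof.
  destruct (linear_bound_nonneg A hA) as (b & hb & hbA).
  exists (/ (1 - r) ^ 2 + b). split.
  { assert (0 < / (1 - r) ^ 2) by (apply Rinv_0_lt_compat, pow_lt; lra). lra. }
  intros w z x hw hz.
  replace (minus (pencil w x) (pencil z x)) with
    (minus (scal (g w - g z)%C x) (scal (w - z)%C (A x))).
  - eapply Rle_trans; [apply (norm_triangle (V := H))|]. rewrite norm_opp.
    replace ((/ (1 - r) ^ 2 + b) * Cmod (w - z) * norm x) with
      (/ (1 - r) ^ 2 * Cmod (w - z) * norm x + Cmod (w - z) * (b * norm x)) by ring.
    apply Rplus_le_compat; (eapply Rle_trans; [apply (norm_scal_C (V := H))|]).
    + apply Rmult_le_compat_r; [apply norm_ge_0|]. now apply diff_symbol_lipschitz.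
    + apply Rmult_le_compat_l; [apply Cmod_ge_0|apply hbA].
  - unfold pencil.
    change (g w - g z)%C with (minus (g w) (g z)). change (w - z)%C with (minus w z).
    rewrite !scal_minus_distr_r. apply: minus_minus_swap.
Qed.

(** Near each point of the closed disc the bound persists with a larger constant by
Lipschitz continuity, and compactness selects one constant. The covering is over
a square; points outside the disc get neighbourhoods that miss it. *)
Lemma pencil_uniform :
  (forall w, Cmod w <= r -> exists M, forall x, norm x <= M * norm (pencil w x)) ->
  exists M, 1 <= M /\ forall w x, Cmod w <= r -> norm x <= M * norm (pencil w x).
Proof.
  intros hP. destruct pencil_lipschitz as (L & hL & hlip).
  assert (hloc : forall p : C, exists d : posreal, forall w x, Cmod w <= r ->
    Rabs (fst w - fst p) < d -> Rabs (snd w - snd p) < d ->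
    norm x <= / d * norm (pencil w x)).
  { intros p.
    assert (hd : forall w d, Rabs (fst w - fst p) < d -> Rabs (snd w - snd p) < d ->
      Cmod (w - p) <= 2 * d).
    { intros w d h1 h2. eapply Rle_trans; [apply Cmod_2Rmax|].
      assert (hs : sqrt 2 <= 2).
      { pose proof (pow2_sqrt 2 ltac:(lra)). pose proof (sqrt_pos 2). nra. }
      apply Rmult_le_compat; [apply sqrt_pos| |easy|].
      - eapply Rle_trans; [apply Rabs_pos|apply Rmax_l].
      - apply Rmax_lub; left; easy. }
    destruct (Rle_lt_dec (Cmod p) r) as [hp|hp].
    - destruct (hP p hp) as [M hM].
      pose (N := Rmax 1 M). assert (hN : 1 <= N) by apply Rmax_l.
      assert (hNx : forall x, norm x <= N * norm (pencil p x)).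
      { intros x. eapply Rle_trans; [apply hM|].
        apply Rmult_le_compat_r; [apply norm_ge_0|apply Rmax_r]. }
      assert (hq : 0 < 4 * N * (L + 1)) by (apply Rmult_lt_0_compat; lra).
      exists (mkposreal _ (Rinv_0_lt_compat _ hq)). simpl. intros w x hw h1 h2.
      specialize (hd w _ h1 h2). specialize (hlip w p x hw hp).
      rewrite Rinv_inv.
      assert (h3 : norm (pencil p x) <= norm (pencil w x) + norm (minus (pencil w x) (pencil p x))).
      { replace (pencil p x) with
          (plus (pencil w x) (opp (minus (pencil w x) (pencil p x)))) at 1.
        - eapply Rle_trans; [apply (norm_triangle (V := H))|]. rewrite norm_opp. apply Rle_refl.
        - unfold minus. by rewrite opp_plus opp_opp plus_assoc plus_opp_r plus_zero_l. }
      pose proof (norm_ge_0 x) as hx. pose proof (norm_ge_0 (pencil w x)) as hy.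
      assert (h4 : L * Cmod (w - p) * norm x <= / (2 * N) * norm x).
      { apply Rmult_le_compat_r; [easy|].
        apply Rle_trans with ((L + 1) * (2 * / (4 * N * (L + 1)))).
        - apply Rmult_le_compat; try lra. apply Cmod_ge_0.
        - right. field. lra. }
      assert (h5 : norm x <= N * norm (pencil w x) + / 2 * norm x).
      { eapply Rle_trans; [apply hNx|].
        replace (/ 2 * norm x) with (N * (/ (2 * N) * norm x)) by (field; lra).
        rewrite -Rmult_plus_distr_l. apply Rmult_le_compat_l; lra. }
      apply Rle_trans with (2 * N * norm (pencil w x)); [lra|].
      apply Rmult_le_compat_r; [easy|]. nra.
    - assert (hq : 0 < (Cmod p - r) / 4) by lra.
      exists (mkposreal _ hq). simpl. intros w x hw h1 h2. exfalso.
      specialize (hd w _ h1 h2).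
      pose proof (Cmod_triangle w (- (w - p))) as ht.
      replace (w + - (w - p))%C with p in ht by ring. rewrite Cmod_opp in ht. lra. }
  destruct (functional_choice _ hloc) as [delta hdelta].
  destruct (compactness_value_2d (- r) r (- r) r (fun (u v : R) => delta (u, v))) as [d hd].
  exists (Rmax 1 (/ d)). split; [apply Rmax_l|]. intros w x hw.
  pose proof (norm_ge_0 (pencil w x)) as hy.
  apply Rle_trans with (/ d * norm (pencil w x));
    [|apply Rmult_le_compat_r; [easy|apply Rmax_r]].
  assert (hbox : forall y, Rabs y <= Cmod w -> - r <= y <= r).
  { intros y hy'. apply Rabs_le_between. lra. }
  pose proof (Rmax_Cmod w) as hmax.
  apply NNPP. intros hn.
  apply (hd (fst w) (snd w)).
  - apply hbox. eapply Rle_trans; [apply Rmax_l|exact hmax].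
  - apply hbox. eapply Rle_trans; [apply Rmax_r|exact hmax].
  - intros (u & v & _ & _ & h1 & h2 & h3). apply hn.
    eapply Rle_trans; [apply (hdelta (u, v) w x hw h1 h2)|].
    apply Rmult_le_compat_r; [easy|]. apply Rinv_le_contravar; [apply cond_pos|easy].
Qed.

Lemma pencil_truncate w x K : (1 <= K)%nat -> Cmod w <= r ->
  norm (minus (pencil w x) (poly_symbol pencil_coef K w x)) <= r ^ S K / (1 - r) * norm x.
Proof.
  intros hK hw. unfold poly_symbol.
  rewrite (sum_pencil_coef w (fun _ => x) K hK).
  pose (s := sum_n (fun k => (a k * Cpow w k)%C) K).
  assert (e : sum_n (fun k => scal (a k * Cpow w k)%C x) K = scal s x).
  { unfold s. clear. induction K as [|n IH]; [now rewrite !sum_O|].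
    rewrite !sum_Sn IH. symmetry. exact (scal_distr_r _ _ _). }
  rewrite e.
  replace (minus (pencil w x) _) with (scal (g w - s)%C x).
  - eapply Rle_trans; [apply (norm_scal_C (V := H))|].
    apply Rmult_le_compat_r; [apply norm_ge_0|]. now apply diff_symbol_tail.
  - unfold pencil. change (g w - s)%C with (minus (g w) s).
    by rewrite scal_minus_distr_r minus_cancel_r.
Qed.

(** Truncating the binomial series far enough doubles the constant of the symbol
bound at most; the polynomial theory applies, and the tail is a small
perturbation of an operator that is already inverted. *)
Lemma pencil_op_invertible :
  (forall w, Cmod w <= r -> exists M, forall x, norm x <= M * norm (pencil w x)) ->
  exists M, 0 <= M /\ coercive pencil_op M /\
    forall D : Z -> Prop, (forall n k, D (n - Z.of_nat k)%Z -> D n) -> solvable D pencil_op M.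
Proof.
  intros hP. destruct (pencil_uniform hP) as (M & hM1 & hM).
  (* The solvability constant of the truncated operator will be 2 M, so the tail
     has to be at most 1 / (4 M). *)
  assert (hK : exists K, (1 <= K)%nat /\ r ^ S K / (1 - r) <= / (4 * M)).
  { assert (hq : 0 < (1 - r) * / (4 * M)).
    { apply Rmult_lt_0_compat; [lra|]. apply Rinv_0_lt_compat; lra. }
    destruct (pow_lt_1_zero r ltac:(rewrite Rabs_pos_eq; lra) _ hq) as [N hN].
    exists (S N); split; [lia|]. specialize (hN (S (S N)) ltac:(lia)).
    rewrite Rabs_pos_eq in hN; [|apply pow_le; lra].
    apply Rmult_le_reg_r with (1 - r); [lra|].
    unfold Rdiv. rewrite Rmult_assoc Rinv_l; [|lra]. lra. }
  destruct hK as (K & hK1 & hK).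
  set (eps := r ^ S K / (1 - r)) in *.
  assert (heps : 0 <= eps) by (apply Rdiv_le_0_compat; [apply pow_le; lra|lra]).
  assert (hMe : M * eps <= / 4).
  { apply Rle_trans with (M * / (4 * M)); [apply Rmult_le_compat_l; lra|right; field; lra]. }
  assert (hpoly : forall w x, Cmod w <= r -> norm x <= 2 * M * norm (poly_symbol pencil_coef K w x)).
  { intros w x hw. pose proof (pencil_truncate w x K hK1 hw) as ht. fold eps in ht.
    specialize (hM w x hw). pose proof (norm_ge_0 x).
    set (p := poly_symbol pencil_coef K w x) in *.
    assert (h3 : norm (pencil w x) <= norm (minus (pencil w x) p) + norm p).
    { replace (pencil w x) with (plus (minus (pencil w x) p) p) at 1.
      - apply (norm_triangle (V := H)).
      - by rewrite minus_plus_cancel. }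
    assert (M * norm (pencil w x) <= M * (eps * norm x) + M * norm p).
    { rewrite -Rmult_plus_distr_l. apply Rmult_le_compat_l; lra. }
    assert (M * (eps * norm x) <= / 2 * norm x).
    { rewrite -Rmult_assoc. apply Rmult_le_compat_r; lra. }
    lra. }
  assert (hr' : 0 <= r <= 1) by lra.
  destruct pencil_op_operator as (B & hB & hT).
  exists (2 * (2 * M)); split; [lra|split].
  - apply (coercive_perturb (conv pencil_coef K (RtoC r)) _ (2 * M) eps); try lra.
    + intros u c hu. now apply pencil_op_diff.
    + apply (conv_coercive pencil_coef K pencil_coef_linear r); try easy; [lra|].
      rewrite Cmod_R Rabs_pos_eq; lra.
  - intros D hD.
    apply (solvable_perturb D (conv pencil_coef K (RtoC r)) _ (2 * M) B eps); try lra.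
    + exact hT.
    + intros u c hu. now apply pencil_op_diff.
    + intros u hu n hn.
      rewrite (pencil_op_vanish_off D u hD hu n hn).
      rewrite (conv_vanish_off _ K pencil_coef_linear D _ u hD hu n hn).
      by rewrite minus_eq_zero.
    + apply (conv_solvable pencil_coef K pencil_coef_linear r); try easy; [lra|lra|].
      apply pencil_coef_0.
Qed.
End Full.

(** * Weighted sequences and the fractional difference operator *)

Lemma is_series_first {V : NormedModule C_AbsRing} (y : nat -> V) :
  (forall k, y (S k) = zero) -> is_series y (y 0%nat).
Proof.
  intros h. apply (filterlim_ext (fun _ => y 0%nat)); [|apply filterlim_const].
  intros N. induction N as [|N IH]; [now rewrite sum_O|]. by rewrite sum_Sn -IH h plus_zero_r.
Qed.

Lemma sum_n_le_Series (a : nat -> R) N :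
  (forall n, 0 <= a n) -> ex_series a -> sum_n a N <= Series a.
Proof.
  intros ha he.
  apply (is_lim_seq_incr_compare (sum_n a)).
  - apply (Series_correct a he).
  - intros n. rewrite sum_Sn. unfold plus; simpl. specialize (ha (S n)). lra.
Qed.

Lemma ex_series_bounded (a : nat -> R) c :
  (forall n, 0 <= a n) -> (forall N, sum_n a N <= c) -> ex_series a /\ Series a <= c.
Proof.
  intros ha hc.
  assert (he : ex_series a).
  { destruct (ex_finite_lim_seq_incr (sum_n a) c) as [l hl]; [|easy|now exists l].
    intros n. rewrite sum_Sn. unfold plus; simpl. specialize (ha (S n)). lra. }
  split; [easy|].
  apply (is_lim_seq_le (sum_n a) (fun _ => c) (Series a) c); [easy| |apply is_lim_seq_const].
  apply (Series_correct a he).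
Qed.

Section Weighted.
Context {H : HilbertSpace} (rho : R).
Hypothesis hrho : 0 < rho.
Implicit Types (u v : Z -> H).

(** Multiplication by rho^{-n}: an isometry onto the unweighted space. *)
Definition weighted u : Z -> H := fun n => scal (RtoC (powerRZ rho (- n))) (u n).

Lemma Cmod_powerRZ n : Cmod (RtoC (powerRZ rho n)) = powerRZ rho n.
Proof. rewrite Cmod_R. apply Rabs_pos_eq, powerRZ_le, hrho. Qed.

Lemma powerRZ_cancel n : powerRZ rho n * powerRZ rho (- n) = 1.
Proof. rewrite -powerRZ_add; [|lra]. now rewrite Z.add_opp_diag_r. Qed.

Lemma weighted_norm u n : norm (weighted u n) = powerRZ rho (- n) * norm (u n).
Proof. unfold weighted. by rewrite norm_scal_C_eq Cmod_powerRZ. Qed.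

Lemma weighted_norm2 u n :
  norm (u n) ^ 2 * powerRZ rho (-2 * n) = norm (weighted u n) ^ 2.
Proof.
  rewrite weighted_norm. replace (-2 * n)%Z with (- n + - n)%Z by lia.
  rewrite powerRZ_add; [|lra]. ring.
Qed.

Lemma unweight_norm u n : norm (u n) = powerRZ rho n * norm (weighted u n).
Proof. rewrite weighted_norm -Rmult_assoc powerRZ_cancel. ring. Qed.

Lemma window_sum_reverse (f : Z -> R) N :
  window_sum f (- Z.of_nat (S N)) (S N) = sum_n (fun n => f (- Z.of_nat (S n))%Z) N.
Proof.
  induction N as [|N IH].
  - rewrite sum_O. simpl. ring.
  - rewrite sum_Sn -IH. remember (S N) as m. cbn [window_sum].
    replace (- Z.of_nat (S m) + 1)%Z with (- Z.of_nat m)%Z by lia. apply Rplus_comm.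
Qed.

Lemma window_sum_split (f : Z -> R) N :
  window_sum f (- Z.of_nat (S N)) (S N + S N) =
  sum_n (fun n => f (Z.of_nat n)) N + sum_n (fun n => f (- Z.of_nat (S n))%Z) N.
Proof.
  rewrite window_sum_cat window_sum_reverse Z.add_opp_diag_l window_sum_sum_n Rplus_comm.
  reflexivity.
Qed.

Lemma ell2_l2le u : ell2 rho u -> l2le (weighted u) (ell2_norm rho u).
Proof.
  intros [h1 h2]. split; [apply sqrt_pos|]. intros a L.
  set (f := fun n => norm (u n) ^ 2 * powerRZ rho (-2 * n)) in *.
  assert (hf : forall n, 0 <= f n).
  { intros n. unfold f. rewrite weighted_norm2. apply pow2_ge_0. }
  assert (h : forall N, window_sum f (- Z.of_nat (S N)) (S N + S N) <= ZSeries f).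
  { intros N. rewrite window_sum_split. unfold ZSeries.
    apply Rplus_le_compat; (apply sum_n_le_Series; [intros n; apply hf|easy]). }
  unfold ell2_norm. fold f. rewrite pow2_sqrt.
  - rewrite -(window_sum_ext f); [|intros n _; apply weighted_norm2].
    eapply Rle_trans; [|apply (h (Z.to_nat (Z.abs a) + L)%nat)].
    apply window_sum_incl; [easy|lia|lia].
  - eapply Rle_trans; [|apply (h 0%nat)]. now apply window_sum_ge0.
Qed.

Lemma l2le_ell2 u c : l2le (weighted u) c -> ell2 rho u /\ ell2_norm rho u <= c.
Proof.
  intros [hc h]. unfold ell2, ell2_norm.
  set (f := fun n => norm (u n) ^ 2 * powerRZ rho (-2 * n)).
  assert (hf : forall n, 0 <= f n).
  { intros n. unfold f. rewrite weighted_norm2. apply pow2_ge_0. }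
  assert (hw : forall N, sum_n (fun n => f (Z.of_nat n)) N +
     sum_n (fun n => f (- Z.of_nat (S n))%Z) N <= c ^ 2).
  { intros N. rewrite -window_sum_split.
    rewrite (window_sum_ext f (fun n => norm (weighted u n) ^ 2)); [apply h|].
    intros n _. apply weighted_norm2. }
  assert (hp : forall (b : nat -> R) N, (forall n, 0 <= b n) -> 0 <= sum_n b N).
  { intros b N hb. induction N as [|N IH]; [now rewrite sum_O|].
    rewrite sum_Sn. now apply Rplus_le_le_0_compat. }
  assert (e1 : ex_series (fun n => f (Z.of_nat n))).
  { apply (ex_series_bounded _ (c ^ 2)); [intros n; apply hf|]. intros N. specialize (hw N).
    pose proof (hp (fun n => f (- Z.of_nat (S n))%Z) N (fun n => hf _)). lra. }
  assert (e2 : ex_series (fun n => f (- Z.of_nat (S n))%Z)).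
  { apply (ex_series_bounded _ (c ^ 2)); [intros n; apply hf|]. intros N. specialize (hw N).
    pose proof (hp (fun n => f (Z.of_nat n)) N (fun n => hf _)). lra. }
  split; [now split|].
  rewrite -(sqrt_pow2 c hc). apply sqrt_le_1_alt.
  apply (is_lim_seq_le (fun N => sum_n (fun n => f (Z.of_nat n)) N +
     sum_n (fun n => f (- Z.of_nat (S n))%Z) N) (fun _ => c ^ 2)
     (ZSeries f) (c ^ 2)); [easy| |apply is_lim_seq_const].
  apply is_lim_seq_plus'; [apply (Series_correct _ e1)|apply (Series_correct _ e2)].
Qed.

Lemma ell2_of_l2le u c : l2le (weighted u) c -> ell2 rho u.
Proof. intros h. now apply (l2le_ell2 u c). Qed.

Lemma weighted_plus u v : weighted (fun k => plus (u k) (v k)) =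
  fun k => plus (weighted u k) (weighted v k).
Proof. extensionality k. unfold weighted. by rewrite scal_distr_l. Qed.

Lemma weighted_scal (c : C) u : weighted (fun k => scal c (u k)) =
  fun k => scal c (weighted u k).
Proof.
  extensionality k. unfold weighted. rewrite !(scal_Cmult (V := H)). f_equal. apply Cmult_comm.
Qed.

Lemma ell2_plus u v : ell2 rho u -> ell2 rho v -> ell2 rho (fun k => plus (u k) (v k)).
Proof.
  intros hu hv. apply ell2_l2le in hu, hv.
  eapply ell2_of_l2le. rewrite weighted_plus. apply (l2le_plus (V := H)); eassumption.
Qed.

Lemma ell2_scal (c : C) u : ell2 rho u -> ell2 rho (fun k => scal c (u k)).
Proof.
  intros hu. apply ell2_l2le in hu.
  eapply ell2_of_l2le. rewrite weighted_scal.
  eapply (l2le_map (weighted u) _ (Cmod c)); [apply Cmod_ge_0| |exact hu].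
  intros n. apply (norm_scal_C (V := H)).
Qed.

Lemma minus_scal (x y : H) : minus x y = plus x (scal (RtoC (-1)) y).
Proof.
  unfold minus. f_equal. rewrite -scal_opp_one. f_equal.
  rewrite RtoC_opp. reflexivity.
Qed.

Lemma ell2_minus u v : ell2 rho u -> ell2 rho v -> ell2 rho (fun k => minus (u k) (v k)).
Proof.
  intros hu hv. replace (fun k => minus (u k) (v k)) with
    (fun k => plus (u k) (scal (RtoC (-1)) (v k))) by (extensionality k; now rewrite minus_scal).
  apply ell2_plus; [easy|now apply ell2_scal].
Qed.

Lemma ell2_shift u m : ell2 rho u -> ell2 rho (fun n => u (n + m)%Z).
Proof.
  intros hu. apply ell2_l2le in hu. eapply ell2_of_l2le.
  eapply (l2le_map (fun n => weighted u (n + m)%Z) _ (powerRZ rho m)).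
  - now apply powerRZ_le.
  - intros n. rewrite !weighted_norm -Rmult_assoc -powerRZ_add; [|lra].
    replace (m + - (n + m))%Z with (- n)%Z by lia. apply Rle_refl.
  - apply l2le_shift, hu.
Qed.

Lemma ell2_delta n (x : H) : ell2 rho (delta n x).
Proof.
  apply (ell2_of_l2le _ (powerRZ rho (- n) * norm x)).
  assert (h0 : 0 <= powerRZ rho (- n) * norm x).
  { apply Rmult_le_pos; [now apply powerRZ_le|apply norm_ge_0]. }
  split; [easy|]. intros a L.
  eapply Rle_trans; [apply (window_sum_supp _ n 1)|].
  - intros m; apply pow2_ge_0.
  - intros m hm. rewrite weighted_norm. unfold delta.
    destruct (Z.eq_dec m n) as [->|_]; [lia|]. rewrite norm_zero. ring.
  - simpl window_sum. rewrite weighted_norm. unfold delta.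
    destruct (Z.eq_dec n n) as [_|hn]; [|easy]. right; ring.
Qed.

Lemma ell2_norm_ge u n : ell2 rho u -> norm (u n) <= powerRZ rho n * ell2_norm rho u.
Proof.
  intros hu. rewrite unweight_norm. apply Rmult_le_compat_l; [now apply powerRZ_le|].
  apply l2le_norm, ell2_l2le, hu.
Qed.
End Weighted.

Section FracOp.
Context {H : HilbertSpace} (A : H -> H) (alpha rho : R).
Hypothesis hA : is_linear A.
Hypothesis halpha : 0 < alpha < 1.
Hypothesis hrho : 1 < rho.
Implicit Types (u v : Z -> H).
Notation T := (frac_op (RtoC alpha) A).
Notation W := (weighted rho).
Notation P := (pencil_op A alpha (/ rho)).

Lemma inv_rho_bounds : 0 <= / rho < 1.
Proof.
  split; [left; apply Rinv_0_lt_compat; lra|].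
  rewrite -Rinv_1. apply Rinv_lt_contravar; lra.
Qed.

Lemma rho_pos : 0 < rho.
Proof. lra. Qed.

Lemma frac_diff_series_weighted u c n : l2le (W u) c ->
  is_series (fun k => scal (diff_coef (RtoC alpha) k) (u (n - Z.of_nat k)%Z))
   (scal (RtoC (powerRZ rho n)) (VSeries (fun k =>
     scal (diff_coef (RtoC alpha) k * Cpow (RtoC (/ rho)) k)%C (W u (n - Z.of_nat k)%Z)))).
Proof.
  intros hu.
  pose proof (pencil_series alpha (/ rho) halpha inv_rho_bounds (W u) c n hu) as hs.
  eapply is_series_ext; [|apply (is_series_scal_l (K := C_AbsRing) (V := H) _ _ _ hs)].
  intros k. cbv beta. unfold weighted. rewrite !(scal_Cmult (V := H)). f_equal.
  set (a := diff_coef _ _).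
  replace (RtoC (powerRZ rho n) * (a * Cpow (RtoC (/ rho)) k) *
    RtoC (powerRZ rho (- (n - Z.of_nat k))))%C
    with (a * RtoC (powerRZ rho n * (/ rho) ^ k * powerRZ rho (- (n - Z.of_nat k))))%C
    by (rewrite !RtoC_mult RtoC_pow; ring).
  replace (powerRZ rho n * (/ rho) ^ k * powerRZ rho (- (n - Z.of_nat k))) with 1; [ring|].
  replace (- (n - Z.of_nat k))%Z with (- n + Z.of_nat k)%Z by lia.
  rewrite powerRZ_add; [|lra]. rewrite -pow_powerRZ pow_inv.
  replace (powerRZ rho n * / rho ^ k * (powerRZ rho (- n) * rho ^ k)) with
    (powerRZ rho n * powerRZ rho (- n) * (/ rho ^ k * rho ^ k)) by ring.
  rewrite powerRZ_cancel; [|lra]. rewrite Rinv_l; [ring|]. apply pow_nonzero; lra.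
Qed.

Lemma frac_diff_series u n : ell2 rho u ->
  is_series (fun k => scal (diff_coef (RtoC alpha) k) (u (n - Z.of_nat k)%Z))
    (frac_diff (RtoC alpha) u n).
Proof.
  intros hu. apply VSeries_correct. eexists.
  apply (frac_diff_series_weighted u _ n (ell2_l2le rho rho_pos u hu)).
Qed.

(** Conjugation by the weights turns the fractional operator into the pencil
convolution, up to the forward shift and the factor rho it costs. *)
Lemma weighted_frac_op u n : ell2 rho u ->
  W (T u) n = scal (RtoC rho) (P (W u) (n + 1)%Z).
Proof.
  intros hu.
  pose proof (frac_diff_series_weighted u _ (n + 1) (ell2_l2le rho rho_pos u hu)) as hs.
  pose proof (is_series_inj _ _ _ (frac_diff_series u (n + 1) hu) hs) as e.
  unfold weighted at 1. unfold frac_op, shift, pencil_op. rewrite e.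
  replace (n + 1 - 1)%Z with n by lia.
  unfold minus. rewrite !scal_distr_l !(scal_Cmult (V := H)). f_equal.
  - f_equal. rewrite -RtoC_mult. f_equal. rewrite -powerRZ_add; [|lra].
    replace (- n + (n + 1))%Z with 1%Z by lia. simpl; ring.
  - rewrite !scal_opp_r. f_equal. rewrite (scal_Cmult (V := H)) -RtoC_mult Rinv_r; [|lra].
    unfold weighted. rewrite (linear_scal _ hA). symmetry. exact (scal_one _).
Qed.

Lemma frac_op_lincomb u v (c : C) n : ell2 rho u -> ell2 rho v ->
  T (fun k => plus (u k) (scal c (v k))) n = plus (T u n) (scal c (T v n)).
Proof.
  intros hu hv. unfold frac_op, shift.
  assert (e : frac_diff (RtoC alpha) (fun k => plus (u k) (scal c (v k))) (n + 1)%Z =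
    plus (frac_diff (RtoC alpha) u (n + 1)%Z) (scal c (frac_diff (RtoC alpha) v (n + 1)%Z))).
  { apply VSeries_unique.
    eapply is_series_ext; [|apply (is_series_plus (K := C_AbsRing) (V := H) _ _ _ _
       (frac_diff_series u (n + 1) hu)
       (is_series_scal_l (K := C_AbsRing) (V := H) c _ _ (frac_diff_series v (n + 1) hv)))].
    intros k. cbv beta. rewrite scal_distr_l. f_equal.
    rewrite !(scal_Cmult (V := H)). f_equal. apply Cmult_comm. }
  by rewrite e (linear_plus _ hA) (linear_scal _ hA) scal_minus_distr_l minus_plus_plus.
Qed.

Lemma frac_op_minus u v n : ell2 rho u -> ell2 rho v ->
  T (fun k => minus (u k) (v k)) n = minus (T u n) (T v n).
Proof.
  intros hu hv. rewrite minus_scal -frac_op_lincomb; try easy.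
  f_equal. extensionality k. apply minus_scal.
Qed.

Lemma frac_op_ell2 u : ell2 rho u -> ell2 rho (T u).
Proof.
  intros hu.
  destruct (pencil_op_operator A alpha (/ rho) hA halpha inv_rho_bounds) as (B & _ & hB).
  pose proof (l2_op_bound _ _ hB _ _ (ell2_l2le rho rho_pos u hu)) as h.
  apply (ell2_of_l2le rho rho_pos (T u) (rho * (B * ell2_norm rho u))).
  eapply (l2le_map (fun n => P (W u) (n + 1)%Z)); [lra| |apply l2le_shift, h].
  intros n. rewrite weighted_frac_op; [|easy]. rewrite norm_scal_C_eq Cmod_R Rabs_pos_eq; lra.
Qed.

Lemma frac_op_shift u m : (fun n => T u (n + m)%Z) = T (fun n => u (n + m)%Z).
Proof.
  extensionality n. unfold frac_op, shift, frac_diff. f_equal. f_equal.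
  extensionality k. do 2 f_equal. lia.
Qed.

(** The operator moves supports one step to the left with leading coefficient 1. *)
Lemma frac_op_lead u a : (forall n, (n < a)%Z -> u n = zero) -> T u (a - 1)%Z = u a.
Proof.
  intros hu. unfold frac_op, shift, frac_diff.
  replace (a - 1 + 1)%Z with a by lia.
  rewrite (hu (a - 1)%Z); [|lia]. rewrite (linear_map_zero _ hA) minus_zero_r.
  rewrite (VSeries_unique _ _ (is_series_first _ _)).
  - change (Cpow (RtoC (-1)) 0 * binom (RtoC alpha) 0)%C with (diff_coef (RtoC alpha) 0).
    rewrite diff_coef_0. replace (a - Z.of_nat 0)%Z with a by lia. exact (scal_one _).
  - intros k. rewrite hu; [|lia]. apply: scal_zero_r.
Qed.

(** Uniqueness makes the chosen solutions linear, and identifies them with the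
solutions found inside a half-line, which gives causality. *)
Lemma frac_op_causal_inverse :
  (forall w, Cmod w <= / rho ->
    exists M, forall x, norm x <= M * norm (pencil A alpha w x)) ->
  exists S, bounded_inverse_ell2 rho T S /\ causal rho S.
Proof.
  intros hP.
  destruct (pencil_op_invertible A alpha (/ rho) hA halpha inv_rho_bounds hP)
    as (M & hM & hco & hso).
  pose proof inv_rho_bounds as hr.
  assert (hco' : forall u c, ell2 rho u -> l2le (W (T u)) c -> l2le (W u) (M * (/ rho * c))).
  { intros u c hu hc. apply (hco (W u) (ell2_norm rho u)); [apply ell2_l2le; [lra|easy]|].
    apply (l2le_map (fun n => W (T u) (n + -1)%Z)); [lra| |now apply l2le_shift].
    intros n. rewrite weighted_frac_op; [|easy].
    replace (n + -1 + 1)%Z with n by lia.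
    rewrite norm_scal_C_eq Cmod_R Rabs_pos_eq; [|lra].
    rewrite -Rmult_assoc Rinv_l; lra. }
  assert (hinj : forall u v, ell2 rho u -> ell2 rho v -> (forall n, T u n = T v n) -> u = v).
  { intros u v hu hv e. extensionality n.
    assert (h0 : l2le (W (T (fun k => minus (u k) (v k)))) 0).
    { eapply l2le_ext; [|apply l2le_zero]. intros m. unfold weighted.
      rewrite frac_op_minus; try easy. by rewrite e minus_eq_zero scal_zero_r. }
    apply hco' in h0; [|apply ell2_minus; [lra|easy|easy]].
    apply (l2le_norm _ _ n) in h0.
    replace (M * (/ rho * 0)) with 0 in h0 by ring.
    assert (h1 : norm (minus (u n) (v n)) = 0).
    { apply Rle_antisym; [|apply norm_ge_0].
      rewrite (unweight_norm rho rho_pos (fun k => minus (u k) (v k)) n).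
      rewrite -(Rmult_0_r (powerRZ rho n)). apply Rmult_le_compat_l; [|easy].
      apply powerRZ_le; lra. }
    apply norm_eq_zero in h1.
    replace (u n) with (plus (minus (u n) (v n)) (v n)); [by rewrite h1 plus_zero_l|].
    by rewrite minus_plus_cancel. }
  assert (hsol : forall (D : Z -> Prop) g, (forall n k, D (n - Z.of_nat k)%Z -> D n) ->
    ell2 rho g -> vanish_off D g ->
    exists u, ell2 rho u /\ vanish_off D u /\ forall n, T u n = g n).
  { intros D g hD hg hgD.
    (* The right-hand side seen by the pencil convolution: the forward shift and
       the factor rho are undone. *)
    pose (G := fun m => scal (RtoC (/ rho)) (W g (m + -1)%Z)).
    assert (hG : l2le G (/ rho * ell2_norm rho g)).
    { apply (l2le_map (fun n => W g (n + -1)%Z)); [lra| |].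
      - intros n. unfold G. rewrite norm_scal_C_eq Cmod_R Rabs_pos_eq; lra.
      - apply l2le_shift, ell2_l2le; [lra|easy]. }
    destruct (hso D hD G _ hG) as (v & hv & hvD & hvG).
    { intros n hn. unfold G, weighted. rewrite hgD; [by rewrite !scal_zero_r|].
      intros h. apply hn. apply (hD n 1%nat). exact h. }
    pose (u := fun n => scal (RtoC (powerRZ rho n)) (v n)).
    assert (huv : forall n, scal (RtoC (powerRZ rho (- n))) (scal (RtoC (powerRZ rho n)) (v n)) = v n).
    { intros n. rewrite (scal_Cmult (V := H)) -RtoC_mult Rmult_comm powerRZ_cancel; [|lra].
      exact (scal_one _). }
    assert (hWu : W u = v) by (extensionality n; apply huv).
    assert (hu : ell2 rho u).
    { apply (ell2_of_l2le rho rho_pos u (M * (/ rho * ell2_norm rho g))). now rewrite hWu. }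
    exists u. split; [easy|split].
    - intros n hn. unfold u. rewrite hvD; [|easy]. by rewrite scal_zero_r.
    - intros n.
      assert (e : W (T u) n = W g n).
      { rewrite weighted_frac_op; [|easy]. rewrite hWu hvG. unfold G.
        rewrite (scal_Cmult (V := H)) -RtoC_mult Rinv_r; [|lra].
        replace (n + 1 + -1)%Z with n by lia. exact (scal_one _). }
      unfold weighted in e. apply (f_equal (scal (RtoC (powerRZ rho n)))) in e.
      rewrite !(scal_Cmult (V := H)) -RtoC_mult powerRZ_cancel in e; [|lra].
      rewrite -(scal_one (T u n)) -(scal_one (g n)). exact e. }
  assert (hch : forall g, exists u, ell2 rho g -> ell2 rho u /\ forall n, T u n = g n).
  { intros g. destruct (classic (ell2 rho g)) as [hg|hg].
    - destruct (hsol (fun _ => True) g) as (u & h1 & _ & h2); try easy. now exists u.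
    - now exists g. }
  destruct (functional_choice _ hch) as [S hS]. exists S. split; [split|].
  - apply frac_op_ell2.
  - split.
    + intros u hu. now apply hS.
    + intros u v hu hv n.
      assert (e : S (fun k => plus (u k) (v k)) =
        fun n => plus (S u n) (scal (RtoC 1) (S v n))).
      { apply hinj.
        - apply hS, ell2_plus; [lra|easy|easy].
        - apply ell2_plus; [lra|now apply hS|]. apply ell2_scal; [lra|now apply hS].
        - intros m. rewrite frac_op_lincomb; [|now apply hS|now apply hS].
          rewrite (proj2 (hS _ (ell2_plus rho rho_pos u v hu hv))).
          rewrite (proj2 (hS u hu)) (proj2 (hS v hv)). f_equal. symmetry. exact (scal_one _). }
      rewrite e. f_equal. exact (scal_one _).
    + intros c u hu n.
      assert (e : S (fun k => scal c (u k)) =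
        fun n => plus (S u n) (scal (c - 1)%C (S u n))).
      { apply hinj.
        - apply hS, ell2_scal; [lra|easy].
        - apply ell2_plus; [lra|now apply hS|]. apply ell2_scal; [lra|now apply hS].
        - intros m. rewrite frac_op_lincomb; [|now apply hS|now apply hS].
          rewrite (proj2 (hS _ (ell2_scal rho rho_pos c u hu))).
          rewrite (proj2 (hS u hu)).
          rewrite -{2}(scal_one (u m)) -scal_distr_r. f_equal.
          change (c = 1 + (c - 1))%C. ring. }
      rewrite e. rewrite -{1}(scal_one (S u n)) -scal_distr_r. f_equal.
      change (1 + (c - 1) = c)%C. ring.
    + exists (M * / rho). intros u hu. rewrite Rmult_assoc.
      apply (l2le_ell2 rho rho_pos). apply hco'; [now apply hS|].
      eapply l2le_ext; [|apply ell2_l2le; [exact rho_pos|exact hu]].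
      intros n. unfold weighted. by rewrite (proj2 (hS u hu)).
  - intros u hu n. replace (S (T u)) with u; [easy|].
    apply hinj; [easy|now apply hS, frac_op_ell2|].
    intros m. now rewrite (proj2 (hS _ (frac_op_ell2 u hu))).
  - intros u hu. now apply hS.
  - intros a g hg hsupp n hn.
    destruct (hsol (fun n => (a <= n)%Z) g) as (u & hu & hD & e); [intros; lia|easy| |].
    { intros m hm. apply NNPP. intros h. apply hm, hsupp, h. }
    assert (e' : S g = u).
    { apply hinj; [now apply hS|easy|]. intros m. rewrite (proj2 (hS g hg)). now rewrite e. }
    apply NNPP. intros h. apply hn. rewrite e'. now apply hD.
Qed.
End FracOp.

(** * Resolvents from a causal inverse *)

Section Inverse.
Context {H : HilbertSpace} (A : H -> H) (alpha rho : R).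
Hypothesis hA : is_linear A.
Hypothesis halpha : 0 < alpha < 1.
Hypothesis hrho : 1 < rho.
Notation T := (frac_op (RtoC alpha) A).
Variable Q : (Z -> H) -> Z -> H.
Hypothesis hS : bounded_inverse_ell2 rho T Q.
Implicit Types (u v g : Z -> H) (x y : H).
Let rho0 : 0 < rho := rho_pos rho hrho.

Lemma inverse_ell2 g : ell2 rho g -> ell2 rho (Q g).
Proof. apply (bounded_ell2_maps _ _ (bounded_inverse_bounded _ _ _ hS)). Qed.

Lemma inverse_plus g v n : ell2 rho g -> ell2 rho v ->
  Q (fun k => plus (g k) (v k)) n = plus (Q g n) (Q v n).
Proof. intros hg hv. now apply (bounded_ell2_plus _ _ (bounded_inverse_bounded _ _ _ hS)). Qed.

Lemma inverse_scal c g n : ell2 rho g -> Q (fun k => scal c (g k)) n = scal c (Q g n).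
Proof. intros hg. now apply (bounded_ell2_scal _ _ (bounded_inverse_bounded _ _ _ hS)). Qed.

Lemma inverse_bound : exists M, 0 < M /\
  forall g, ell2 rho g -> ell2_norm rho (Q g) <= M * ell2_norm rho g.
Proof.
  destruct (bounded_ell2_norm _ _ (bounded_inverse_bounded _ _ _ hS)) as [M hM].
  exists (Rmax 1 M); split; [pose proof (Rmax_l 1 M); lra|].
  intros g hg. eapply Rle_trans; [now apply hM|].
  apply Rmult_le_compat_r; [apply sqrt_pos|apply Rmax_r].
Qed.

(** A two-sided inverse of a shift-invariant operator is shift invariant. *)
Lemma inverse_shift g m n : ell2 rho g -> Q (fun k => g (k + m)%Z) n = Q g (n + m)%Z.
Proof.
  intros hg. pose proof (inverse_ell2 g hg) as hu.
  assert (e : T (fun k => Q g (k + m)%Z) = fun k => g (k + m)%Z).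
  { rewrite -frac_op_shift. extensionality k. now apply (bounded_inverse_r _ _ _ hS). }
  transitivity (Q (T (fun k => Q g (k + m)%Z)) n); [by rewrite e|].
  apply (bounded_inverse_l _ _ _ hS (fun k => Q g (k + m)%Z)). now apply ell2_shift.
Qed.

(** Causality gives support from -1 on for the solution u, and the equation at
index -2 reads u_{-1} = 0. *)
Lemma causal_inverse_strict : causal rho Q ->
  forall x n, (n < 0)%Z -> Q (delta (-1)%Z x) n = zero.
Proof.
  intros hc x n hn.
  assert (hd := ell2_delta rho rho0 (-1) x).
  assert (hsupp : forall m, (m < -1)%Z -> Q (delta (-1)%Z x) m = zero).
  { intros m hm. apply NNPP. intros h.
    enough (-1 <= m)%Z by lia.
    apply (hc (-1)%Z _ hd); [|exact h].
    intros k hk. unfold spt, delta in hk. destruct (Z.eq_dec k (-1)) as [->|_]; [lia|easy]. }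
  destruct (Z.eq_dec n (-1)) as [->|hn']; [|apply hsupp; lia].
  rewrite -(frac_op_lead A alpha hA _ (-1) hsupp).
  rewrite (bounded_inverse_r _ _ _ hS); [|easy].
  unfold delta. now destruct (Z.eq_dec (-1 - 1) (-1)).
Qed.

(** A gain of one step over causality, matching the shift in the operator. *)
Definition strictly_causal : Prop :=
  forall a g, ell2 rho g -> (forall n, (n < a)%Z -> g n = zero) ->
  forall n, (n <= a)%Z -> Q g n = zero.

(** Shift invariance moves the hypothesis to impulses at any place, linearity to
finitely supported inputs, and boundedness to their limits. *)
Lemma strictly_causal_of_delta :
  (forall x n, (n < 0)%Z -> Q (delta (-1)%Z x) n = zero) -> strictly_causal.
Proof.
  intros hd a g hg ha n hn.
  assert (hdelta : forall k x m, (m <= k)%Z -> Q (delta k x) m = zero).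
  { intros k x m hm.
    replace (delta k x) with (fun j => delta (-1)%Z x (j + (-1 - k))%Z).
    - rewrite inverse_shift; [|now apply ell2_delta]. apply hd; lia.
    - extensionality j. unfold delta.
      destruct (Z.eq_dec (j + (-1 - k)) (-1)), (Z.eq_dec j k); try easy; lia. }
  (* Truncations of g from the right, built up one impulse at a time. *)
  pose (F := fun (j : nat) m => if (m <? a + Z.of_nat j)%Z then g m else zero).
  assert (hF : forall j, ell2 rho (F j)).
  { intros j. eapply (ell2_of_l2le rho rho0).
    eapply l2le_dom; [|apply (ell2_l2le rho rho0 g hg)].
    intros m. rewrite !(weighted_norm rho rho0). apply Rmult_le_compat_l; [now apply powerRZ_le|].
    unfold F. destruct (Z.ltb_spec m (a + Z.of_nat j)); [lra|]. rewrite norm_zero. apply norm_ge_0. }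
  assert (hSF : forall j, Q (F j) n = zero).
  { induction j as [|j IH].
    - replace (F 0%nat) with (fun k => scal (RtoC 0) (g k)).
      + rewrite inverse_scal; [|easy]. exact (scal_zero_l _).
      + extensionality m. unfold F. destruct (Z.ltb_spec m (a + Z.of_nat 0)).
        * rewrite ha; [|lia]. by rewrite scal_zero_r.
        * exact (scal_zero_l _).
    - replace (F (S j)) with
        (fun k => plus (F j k) (delta (a + Z.of_nat j) (g (a + Z.of_nat j)%Z) k)).
      + rewrite inverse_plus; [|easy|now apply ell2_delta].
        rewrite IH hdelta; [|lia]. by rewrite plus_zero_l.
      + extensionality m. unfold F, delta.
        destruct (Z.ltb_spec m (a + Z.of_nat j)), (Z.ltb_spec m (a + Z.of_nat (S j))),
          (Z.eq_dec m (a + Z.of_nat j)) as [->|]; try lia;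
          by rewrite ?plus_zero_l ?plus_zero_r. }
  destruct inverse_bound as (M & hM & hbound).
  assert (hsmall : forall eps, 0 < eps -> norm (Q g n) <= powerRZ rho n * (M * eps)).
  { intros eps heps.
    destruct (l2le_tail (weighted rho g) _ eps (ell2_l2le rho rho0 g hg) heps) as [N hN].
    pose (j := (Z.to_nat (Z.of_nat N + 1 - a))).
    pose (d := fun k => minus (g k) (F j k)).
    assert (hd1 : l2le (weighted rho d) eps).
    { eapply l2le_dom; [|exact hN]. intros m. unfold weighted, d, trunc, F.
      destruct (Z.ltb_spec m (a + Z.of_nat j)).
      - rewrite minus_eq_zero scal_zero_r norm_zero. apply norm_ge_0.
      - rewrite minus_zero_r. destruct (Z.leb_spec (Z.abs m) (Z.of_nat N)); [lia|].
        rewrite minus_zero_r. apply Rle_refl. }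
    destruct (l2le_ell2 rho rho0 d eps hd1) as [hd2 hd3].
    assert (e : Q g n = Q d n).
    { replace (Q g n) with (Q (fun k => plus (F j k) (d k)) n).
      - rewrite inverse_plus; [|easy|easy]. by rewrite hSF plus_zero_l.
      - f_equal. extensionality k. unfold d, minus.
        by rewrite (plus_comm (g k)) plus_assoc plus_opp_r plus_zero_l. }
    rewrite e. eapply Rle_trans; [apply (ell2_norm_ge rho rho0), inverse_ell2, hd2|].
    apply Rmult_le_compat_l; [now apply powerRZ_le|].
    eapply Rle_trans; [now apply hbound|]. apply Rmult_le_compat_l; lra. }
  apply (norm_eq_zero (V := H)). apply Rle_antisym; [|apply norm_ge_0].
  apply Rnot_lt_le. intros hlt.
  assert (hp : 0 < powerRZ rho n) by now apply powerRZ_lt.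
  assert (hq : 0 < powerRZ rho n * M) by now apply Rmult_lt_0_compat.
  specialize (hsmall (norm (Q g n) / (2 * (powerRZ rho n * M)))).
  assert (he : 0 < norm (Q g n) / (2 * (powerRZ rho n * M))) by (apply Rdiv_lt_0_compat; lra).
  specialize (hsmall he).
  replace (powerRZ rho n * (M * (norm (Q g n) / (2 * (powerRZ rho n * M)))))
    with (norm (Q g n) / 2) in hsmall by (field; lra).
  lra.
Qed.

(** On a sequence that is geometric towards minus infinity the convolution series is
the binomial series itself, so the operator acts as f(z) - A. *)
Lemma frac_op_geometric w u N : ell2 rho u -> w <> RtoC 0 -> Cmod w <= / rho ->
  (forall m, (m <= N)%Z -> u (m - 1)%Z = scal w (u m)) ->
  T u (N - 1)%Z =
  minus (scal (f_frac (RtoC alpha) (/ w)) (u (N - 1)%Z)) (A (u (N - 1)%Z)).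
Proof.
  intros hu hw hwr hrec. unfold frac_op, shift.
  replace (N - 1 + 1)%Z with N by lia. f_equal.
  assert (hpow : forall k, u (N - Z.of_nat k)%Z = scal (Cpow w k) (u N)).
  { induction k as [|k IH].
    - replace (N - Z.of_nat 0)%Z with N by lia. symmetry. exact (scal_one _).
    - replace (N - Z.of_nat (S k))%Z with (N - Z.of_nat k - 1)%Z by lia.
      rewrite hrec; [|lia]. by rewrite IH (scal_Cmult (V := H)). }
  rewrite hrec; [|lia]. rewrite (scal_Cmult (V := H)).
  rewrite f_frac_symbol.
  replace (/ / w)%C with w by (field; split; [exact hw|apply C1_nz] || (field; exact hw)).
  replace (/ w * diff_symbol (RtoC alpha) w * w)%C with (diff_symbol (RtoC alpha) w)
    by (field; exact hw).
  apply VSeries_unique.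
  eapply is_series_ext; [|apply is_series_scal_vector,
    (is_series_diff_symbol alpha (/ rho) halpha (inv_rho_bounds rho hrho) w hwr)].
  intros k. cbv beta. rewrite hpow (scal_Cmult (V := H)). reflexivity.
Qed.

(** The truncation of the eigensequence z^n x, z = 1/w, to n <= 0: it is
square-summable for the weight as soon as |w| rho < 1. *)
Definition geometric (w : C) (x : H) : Z -> H :=
  fun n => if (n <=? 0)%Z then scal (Cpow w (Z.to_nat (- n))) x else zero.

Lemma geometric_0 w x : geometric w x 0%Z = x.
Proof. exact (scal_one x). Qed.

Lemma geometric_rec w x m : (m <= 0)%Z ->
  geometric w x (m - 1)%Z = scal w (geometric w x m).
Proof.
  intros hm. unfold geometric.
  destruct (Z.leb_spec m 0), (Z.leb_spec (m - 1) 0); try lia.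
  rewrite (scal_Cmult (V := H)).
  replace (Z.to_nat (- (m - 1))) with (S (Z.to_nat (- m))) by lia. reflexivity.
Qed.

Lemma geometric_plus w x y :
  geometric w (plus x y) = fun k => plus (geometric w x k) (geometric w y k).
Proof.
  extensionality k. unfold geometric. destruct (Z.leb_spec k 0).
  - by rewrite scal_distr_l.
  - by rewrite plus_zero_l.
Qed.

Lemma geometric_scal w c x :
  geometric w (scal c x) = fun k => scal c (geometric w x k).
Proof.
  extensionality k. unfold geometric. destruct (Z.leb_spec k 0).
  - rewrite !(scal_Cmult (V := H)). f_equal. apply Cmult_comm.
  - by rewrite scal_zero_r.
Qed.

(** The constant K depends on w and blows up as |w| rho tends to 1; it is never
estimated because it cancels in operator bounds. *)
Lemma geometric_norm w : Cmod w < / rho -> exists K, 0 < K /\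
  forall x, ell2 rho (geometric w x) /\ ell2_norm rho (geometric w x) = K * norm x.
Proof.
  intros hw.
  pose (k := fun n : Z => if (n <=? 0)%Z then Cmod w ^ Z.to_nat (- n) else 0).
  pose (b := fun n : Z => k n ^ 2 * powerRZ rho (-2 * n)).
  pose (q := Cmod w * rho).
  assert (hq : 0 <= q < 1).
  { unfold q. pose proof (Cmod_ge_0 w). split; [nra|].
    apply Rmult_lt_compat_r with (r := rho) in hw; [|lra]. rewrite Rinv_l in hw; lra. }
  assert (hq2 : 0 <= q ^ 2 < 1) by nra.
  assert (hb0 : forall n, 0 <= b n).
  { intros n. unfold b. apply Rmult_le_pos; [apply pow2_ge_0|apply powerRZ_le; lra]. }
  assert (hgeom : ex_series (fun n => (q ^ 2) ^ n)).
  { exists (/ (1 - q ^ 2)). apply is_series_geom. rewrite Rabs_pos_eq; lra. }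
  assert (hneg : forall n : nat, b (- Z.of_nat n)%Z = (q ^ 2) ^ n).
  { intros n. unfold b, k, q. destruct (Z.leb_spec (- Z.of_nat n) 0); [|lia].
    replace (Z.to_nat (- - Z.of_nat n)) with n by lia.
    replace (-2 * - Z.of_nat n)%Z with (Z.of_nat (2 * n)) by lia.
    rewrite -pow_powerRZ !pow_mult Rpow_mult_distr Rpow_mult_distr -!pow_mult.
    rewrite (Nat.mul_comm n 2). reflexivity. }
  assert (hex : ex_zseries b).
  { split.
    - apply (ex_series_le (K := R_AbsRing) (V := R_CompleteNormedModule) _
        (fun n => (q ^ 2) ^ n)); [|easy].
      intros n. change (Rabs (b (Z.of_nat n)) <= (q ^ 2) ^ n).
      rewrite Rabs_pos_eq; [|easy].
      destruct n as [|n]; [right; apply (hneg 0%nat)|].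
      unfold b, k. destruct (Z.leb_spec (Z.of_nat (S n)) 0); [lia|].
      rewrite pow_ne_zero; [|lia]. rewrite Rmult_0_l. apply pow_le; lra.
    - apply (ex_series_le (K := R_AbsRing) (V := R_CompleteNormedModule) _
        (fun n => (q ^ 2) ^ n)); [|easy].
      intros n. change (Rabs (b (- Z.of_nat (S n))%Z) <= (q ^ 2) ^ n).
      rewrite hneg Rabs_pos_eq; [|apply pow_le; lra].
      simpl. assert (0 <= (q * (q * 1)) ^ n) by (apply pow_le; nra). nra. }
  destruct hex as [hex1 hex2].
  exists (sqrt (ZSeries b)). split.
  - apply sqrt_lt_R0. unfold ZSeries. apply Rlt_le_trans with (1 + 0); [lra|].
    apply Rplus_le_compat.
    + eapply Rle_trans; [|apply (sum_n_le_Series _ 0); [intros; apply hb0|easy]].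
      rewrite sum_O. right. symmetry. exact (hneg 0%nat).
    + eapply Rle_trans; [|apply (sum_n_le_Series _ 0); [intros; apply hb0|easy]].
      rewrite sum_O. apply hb0.
  - intros x.
    assert (e : (fun n => norm (geometric w x n) ^ 2 * powerRZ rho (-2 * n)) =
      fun n => b n * norm x ^ 2).
    { extensionality n. unfold b, k, geometric. destruct (Z.leb_spec n 0).
      - rewrite norm_scal_C_eq Cmod_pow. ring.
      - rewrite norm_zero. ring. }
    unfold ell2, ell2_norm. rewrite e. split.
    + split; apply ex_series_scal_r; easy.
    + unfold ZSeries. rewrite !Series_scal_r -Rmult_plus_distr_r sqrt_mult_alt.
      * rewrite (sqrt_pow2 (norm x)); [easy|apply norm_ge_0].
      * apply Rplus_le_le_0_compat.
        -- eapply Rle_trans; [|apply (sum_n_le_Series _ 0); [intros; apply hb0|easy]].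
           rewrite sum_O. apply hb0.
        -- eapply Rle_trans; [|apply (sum_n_le_Series _ 0); [intros; apply hb0|easy]].
           rewrite sum_O. apply hb0.
Qed.

(** Shifting the half-line sequence multiplies it by w up to an impulse at index 1,
which a strictly causal Q cannot see at indices <= 1; hence Q maps it to a
sequence that is geometric on the half-line. Its value at 0 is the resolvent
applied to x. The bound M is that of Q, uniformly in w. *)
Lemma resolvent_outside : strictly_causal -> exists M, 0 < M /\
  forall w, w <> RtoC 0 -> Cmod w < / rho ->
  let lambda := f_frac (RtoC alpha) (/ w) in
  exists Y : H -> H, is_linear Y /\ (forall x, norm (Y x) <= M * norm x) /\
    (forall x, Y (minus (scal lambda x) (A x)) = x) /\
    (forall x, minus (scal lambda (Y x)) (A (Y x)) = x).
Proof.
  intros hcaus. destruct inverse_bound as (M & hM & hbound).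
  exists M; split; [easy|]. intros w hw0 hw lambda.
  destruct (geometric_norm w hw) as (K & hK & hgeo).
  assert (hell : forall x, ell2 rho (geometric w x)) by apply hgeo.
  pose (Y := fun x => Q (geometric w x) 0%Z).
  assert (hrec : forall x n, (n <= 1)%Z ->
    Q (geometric w x) (n - 1)%Z = scal w (Q (geometric w x) n)).
  { intros x n hn.
    assert (e : (fun k => geometric w x (k + -1)%Z) =
      fun k => plus (scal w (geometric w x k)) (delta 1 x k)).
    { extensionality k. unfold delta.
      destruct (Z.eq_dec k 1) as [->|hk].
      - change (1 + -1)%Z with 0%Z. rewrite geometric_0.
        change (geometric w x 1%Z) with (zero : H). by rewrite scal_zero_r plus_zero_l.
      - rewrite plus_zero_r. destruct (Z.le_gt_cases k 0) as [hk0|hk0].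
        + now apply geometric_rec.
        + unfold geometric. destruct (Z.leb_spec (k + -1) 0), (Z.leb_spec k 0); try lia.
          by rewrite scal_zero_r. }
    change (n - 1)%Z with (n + -1)%Z. rewrite -inverse_shift; [|easy].
    rewrite e inverse_plus; [|now apply ell2_scal|now apply ell2_delta].
    rewrite inverse_scal; [|easy].
    rewrite (hcaus 1%Z (delta 1 x)); [by rewrite plus_zero_r| | |easy].
    - now apply ell2_delta.
    - intros m hm. unfold delta. destruct (Z.eq_dec m 1); [lia|easy]. }
  assert (hval : forall x n, (n <= 0)%Z -> Q (geometric w x) n = geometric w (Y x) n).
  { intros x n hn. replace n with (- Z.of_nat (Z.to_nat (- n)))%Z by lia.
    induction (Z.to_nat (- n)) as [|k IH].
    - symmetry; apply geometric_0.
    - replace (- Z.of_nat (S k))%Z with (- Z.of_nat k - 1)%Z by lia.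
      rewrite hrec; [|lia]. rewrite geometric_rec; [|lia]. by rewrite IH. }
  assert (hYbound : forall x, norm (Y x) <= M * norm x).
  { intros x. apply Rmult_le_reg_l with K; [easy|].
    rewrite -(proj2 (hgeo (Y x))).
    replace (K * (M * norm x)) with (M * (K * norm x)) by ring.
    rewrite -(proj2 (hgeo x)).
    eapply Rle_trans; [|now apply hbound].
    apply (l2le_ell2 rho rho0).
    eapply l2le_dom; [|apply (ell2_l2le rho rho0), inverse_ell2, (hell x)].
    intros n. rewrite !(weighted_norm rho rho0).
    apply Rmult_le_compat_l; [now apply powerRZ_le|].
    destruct (Z.le_gt_cases n 0) as [hn|hn].
    - rewrite hval; [apply Rle_refl|easy].
    - unfold geometric at 1. destruct (Z.leb_spec n 0); [lia|].
      rewrite norm_zero. apply norm_ge_0. }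
  assert (hYplus : forall x y, Y (plus x y) = plus (Y x) (Y y)).
  { intros x y. unfold Y. rewrite geometric_plus. now apply inverse_plus. }
  exists Y. split; [split|split; [easy|split]].
  - exact hYplus.
  - intros c x. unfold Y. rewrite geometric_scal. now apply inverse_scal.
  - now exists M.
  - intros x.
    set (y := minus (scal lambda x) (A x)).
    (* T maps the half-line sequence of x to that of y up to a remainder supported
       on indices >= 0, whose image under Q vanishes at 0. *)
    pose (h := fun k => minus (T (geometric w x) k) (geometric w y k)).
    assert (hT : ell2 rho (T (geometric w x))) by now apply frac_op_ell2.
    assert (hh : ell2 rho h) by now apply ell2_minus.
    assert (hh0 : Q h 0%Z = zero).
    { apply (hcaus 0%Z h hh); [|lia]. intros n hn. unfold h.
      replace n with (n + 1 - 1)%Z by lia.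
      rewrite (frac_op_geometric w _ (n + 1)%Z (hell x) hw0 (Rlt_le _ _ hw)).
      - replace (n + 1 - 1)%Z with n by lia.
        unfold geometric. destruct (Z.leb_spec n 0); [|lia].
        set (c := Cpow w _). fold lambda. unfold y.
        rewrite (linear_scal _ hA) scal_minus_distr_l !(scal_Cmult (V := H)).
        rewrite (Cmult_comm lambda c). by rewrite minus_eq_zero.
      - intros m hm. apply geometric_rec; lia. }
    assert (e : Q (T (geometric w x)) 0%Z = plus (Y y) (Q h 0%Z)).
    { unfold Y. rewrite -inverse_plus; [|easy|easy]. f_equal. extensionality k.
      unfold h, minus. by rewrite plus_comm -plus_assoc plus_opp_l plus_zero_r. }
    rewrite (bounded_inverse_l _ _ _ hS) in e; [|easy].
    rewrite hh0 plus_zero_r geometric_0 in e. now symmetry.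
  - intros x.
    assert (e := bounded_inverse_r _ _ _ hS (geometric w x) (hell x) 0%Z).
    rewrite geometric_0 in e.
    transitivity (T (Q (geometric w x)) 0%Z); [|exact e].
    symmetry. apply (frac_op_geometric w (Q (geometric w x)) 1%Z); try easy.
    + now apply inverse_ell2.
    + now left.
    + intros m hm. now apply hrec.
Qed.
End Inverse.

(** * The spectral condition *)

(** Openness of the resolvent set with an explicit radius. The Neumann series is the
one for sequences, applied to operators acting entrywise and to an impulse. *)
Lemma resolvent_open {H : HilbertSpace} (A : H -> H) (lambda lambda0 : C) M (Y : H -> H) :
  is_linear A -> 0 < M -> (forall x, norm (Y x) <= M * norm x) ->
  (forall x, Y (minus (scal lambda x) (A x)) = x) ->
  (forall x, minus (scal lambda (Y x)) (A (Y x)) = x) ->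
  M * Cmod (lambda0 - lambda) <= / 2 ->
  ~ spectrum A lambda0.
Proof.
  intros hA hM hY hl hr hd hspec. apply hspec. clear hspec.
  set (d := Cmod (lambda0 - lambda)) in *.
  assert (hd0 : 0 <= d) by apply Cmod_ge_0.
  pose (T := fun (c : C) (u : Z -> H) n => minus (scal c (u n)) (A (u n))).
  destruct (linear_bound_nonneg A hA) as (b & hb & hbA).
  assert (hB : 0 <= Cmod lambda0 + b) by (pose proof (Cmod_ge_0 lambda0); lra).
  assert (hsol : solvable (fun _ => True) (T lambda0) (2 * M)).
  { apply (solvable_perturb _ (T lambda) _ M (Cmod lambda0 + b) d); try easy; try lra.
    - split.
      + intros u c hu. apply (l2le_map u); [easy| |easy]. intros n. unfold T.
        eapply Rle_trans; [apply (norm_triangle (V := H))|].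
        rewrite norm_opp Rmult_plus_distr_r.
        apply Rplus_le_compat; [apply (norm_scal_C (V := H))|apply hbA].
      + intros u v _ _ _ _ n. unfold T. rewrite (linear_plus _ hA) scal_distr_l.
        apply: minus_plus_plus.
      + intros u _ _ n. unfold T. rewrite (linear_map_opp _ hA) scal_opp_r. unfold minus.
        by rewrite opp_plus.
    - intros u c hu. apply (l2le_map u); [easy| |easy]. intros n. unfold T.
      rewrite minus_cancel_r -scal_minus_distr_r. apply (norm_scal_C (V := H)).
    - intros g c hg _. exists (fun n => Y (g n)). split; [|split].
      + apply (l2le_map g); [lra| |easy]. intros n; apply hY.
      + intros n hn. now destruct hn.
      + intros n. apply hr. }
  assert (hsurj : forall x, exists y, minus (scal lambda0 y) (A y) = x).
  { intros x.
    destruct (hsol (delta 0 x) (norm x)) as (u & _ & _ & hu).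
    - split; [apply norm_ge_0|]. intros a L.
      eapply Rle_trans; [apply (window_sum_supp _ 0 1)|].
      + intros n; apply pow2_ge_0.
      + intros n hn. unfold delta. destruct (Z.eq_dec n 0) as [->|_]; [lia|].
        rewrite norm_zero. ring.
      + cbn [window_sum]. unfold delta. destruct (Z.eq_dec 0 0); [|easy]. right; ring.
    - intros n hn. now destruct hn.
    - exists (u 0%Z). exact (hu 0%Z). }
  assert (hbelow : forall x, norm x <= 2 * M * norm (minus (scal lambda0 x) (A x))).
  { intros x.
    assert (h1 : norm x <= M * norm (minus (scal lambda x) (A x))).
    { rewrite -{1}(hl x). apply hY. }
    assert (h2 : norm (minus (scal lambda x) (A x)) <=
      norm (minus (scal lambda0 x) (A x)) + d * norm x).
    { replace (minus (scal lambda x) (A x)) with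
        (plus (minus (scal lambda0 x) (A x)) (opp (scal (lambda0 - lambda)%C x))).
      - eapply Rle_trans; [apply (norm_triangle (V := H))|]. rewrite norm_opp.
        apply Rplus_le_compat_l, (norm_scal_C (V := H)).
      - change (lambda0 - lambda)%C with (minus lambda0 lambda).
        rewrite scal_minus_distr_r. apply: minus_cancel_l. }
    pose proof (norm_ge_0 x). set (N := norm (minus (scal lambda0 x) (A x))) in *.
    assert (M * norm (minus (scal lambda x) (A x)) <= M * (N + d * norm x))
      by (apply Rmult_le_compat_l; lra).
    assert (M * d * norm x <= / 2 * norm x) by (apply Rmult_le_compat_r; lra).
    lra. }
  assert (hsub : forall x y, minus (minus (scal lambda0 x) (A x)) (minus (scal lambda0 y) (A y)) =
    minus (scal lambda0 (minus x y)) (A (minus x y))).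
  { intros x y. rewrite minus_minus_swap. unfold minus at 5 6.
    by rewrite (linear_plus _ hA) (linear_map_opp _ hA) scal_distr_l scal_opp_r. }
  assert (hinj : forall x y, minus (scal lambda0 x) (A x) = minus (scal lambda0 y) (A y) -> x = y).
  { intros x y e.
    assert (hz : norm (minus x y) = 0).
    { apply Rle_antisym; [|apply norm_ge_0].
      eapply Rle_trans; [apply hbelow|]. rewrite -hsub e norm_minus_self. right; ring. }
    apply norm_eq_zero in hz.
    replace x with (plus (minus x y) y); [by rewrite hz plus_zero_l|].
    by rewrite minus_plus_cancel. }
  destruct (functional_choice _ hsurj) as [B hB'].
  exists B. split; [split|split; [|exact hB']].
  - intros x y. apply hinj. rewrite hB' (linear_plus _ hA) scal_distr_l.
    rewrite -{1}(hB' x) -{1}(hB' y). symmetry. apply: minus_plus_plus.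
  - intros c x. apply hinj. rewrite hB' (linear_scal _ hA).
    rewrite -{1}(hB' x) scal_minus_distr_l !(scal_Cmult (V := H)). by rewrite (Cmult_comm c).
  - exists (2 * M). split; [lra|]. intros x. eapply Rle_trans; [apply hbelow|].
    rewrite hB'. apply Rle_refl.
  - intros x. apply hinj. apply hB'.
Qed.

Lemma diff_symbol_0 alpha : diff_symbol alpha (RtoC 0) = RtoC 1.
Proof.
  unfold diff_symbol.
  rewrite (VSeries_unique _ _ (is_series_first (V := C_NormedModule) _ _)).
  - rewrite Cmult_1_r. apply diff_coef_0.
  - intros k. rewrite Cpow_S Cmult_0_l. apply Cmult_0_r.
Qed.

(** Along the segment t w0, with t <= 1, the symbol is Lipschitz and 1/t stays
bounded. *)
Lemma f_frac_radial_continuity alpha r (w0 : C) : 0 < alpha < 1 -> 0 < r < 1 -> Cmod w0 = r ->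
  exists Lc, 0 < Lc /\ forall t, / 2 <= t <= 1 ->
  Cmod (f_frac (RtoC alpha) (/ w0) - f_frac (RtoC alpha) (/ (RtoC t * w0))) <= Lc * (1 - t).
Proof.
  intros halpha hr hw0.
  assert (hr0 : 0 <= r < 1) by lra.
  assert (hw : w0 <> RtoC 0) by (intros e; rewrite e Cmod_0 in hw0; lra).
  pose (L := / (1 - r) ^ 2).
  assert (hL : 0 < L) by (apply Rinv_0_lt_compat, pow_lt; lra).
  assert (hir : 0 < / r) by (apply Rinv_0_lt_compat; lra).
  exists (/ r * (2 * (L + 1) + L)). split; [apply Rmult_lt_0_compat; lra|].
  intros t ht.
  set (w := (RtoC t * w0)%C).
  assert (hwr : Cmod w <= r).
  { unfold w. rewrite Cmod_mult Cmod_R hw0 Rabs_pos_eq; nra. }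
  pose (g := diff_symbol (RtoC alpha)).
  assert (hlip : Cmod (g w0 - g w) <= L * (1 - t)).
  { eapply Rle_trans; [apply (diff_symbol_lipschitz alpha r halpha hr0); [lra|easy]|].
    apply Rmult_le_compat_l; [lra|].
    replace (w0 - w)%C with (RtoC (1 - t) * w0)%C by (unfold w; rewrite RtoC_minus; ring).
    rewrite Cmod_mult Cmod_R hw0 Rabs_pos_eq; nra. }
  assert (hg : Cmod (g w) <= L + 1).
  { replace (g w) with ((g w - g (RtoC 0)) + RtoC 1)%C
      by (unfold g at 2; rewrite diff_symbol_0; ring).
    eapply Rle_trans; [apply Cmod_triangle|]. rewrite Cmod_1. apply Rplus_le_compat_r.
    eapply Rle_trans.
    - apply (diff_symbol_lipschitz alpha r halpha hr0); [easy|]. rewrite Cmod_0; lra.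
    - fold L. replace (w - RtoC 0)%C with w by ring. nra. }
  assert (htC : RtoC t <> RtoC 0) by (intros e; apply RtoC_inj in e; lra).
  rewrite !f_frac_symbol.
  replace (/ / w0)%C with w0 by (field; exact hw).
  replace (/ / w)%C with w
    by (unfold w; field; split; [exact hw|exact htC] || (field; split; assumption)).
  fold g.
  replace (/ w0 * g w0 - / w * g w)%C with
    (/ w0 * ((g w0 - g w) + RtoC (1 - / t) * g w))%C.
  2:{ unfold w. rewrite RtoC_minus RtoC_inv; [|lra]. field. split; assumption. }
  rewrite Cmod_mult Cmod_inv; [|easy]. rewrite hw0 Rmult_assoc.
  apply Rmult_le_compat_l; [lra|].
  eapply Rle_trans; [apply Cmod_triangle|].
  rewrite Cmod_mult Cmod_R.
  assert (hti : Rabs (1 - / t) <= 2 * (1 - t)).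
  { rewrite Rabs_minus_sym Rabs_pos_eq.
    - apply Rmult_le_reg_r with t; [lra|].
      rewrite Rmult_minus_distr_r Rinv_l; [|lra]. nra.
    - assert (1 <= / t); [|lra]. rewrite -{1}Rinv_1. apply Rinv_le_contravar; lra. }
  assert (Rabs (1 - / t) * Cmod (g w) <= 2 * (1 - t) * (L + 1)).
  { apply Rmult_le_compat; [apply Rabs_pos|apply Cmod_ge_0|easy|easy]. }
  lra.
Qed.

(** Outside the circle |z| = rho the resolvent is explicit. A point of the circle is
a radial limit of such points, along which the resolvents stay bounded by M, so
it lies within the radius of openness of one of them. *)
Lemma strictly_causal_spectrum {H : HilbertSpace} (A : H -> H) (alpha rho : R) Q :
  is_linear A -> 0 < alpha < 1 -> 1 < rho ->
  bounded_inverse_ell2 rho (frac_op (RtoC alpha) A) Q ->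
  strictly_causal rho Q ->
  forall z, rho <= Cmod z -> ~ spectrum A (f_frac (RtoC alpha) z).
Proof.
  intros hA halpha hrho hQ hcaus z hz.
  destruct (resolvent_outside A alpha rho hA halpha hrho Q hQ hcaus) as (M & hM & hres).
  assert (hz0 : z <> RtoC 0) by (intros e; rewrite e Cmod_0 in hz; lra).
  assert (hmod : Cmod (/ z) = / Cmod z) by now apply Cmod_inv.
  assert (hinv : z = (/ / z)%C) by (field; exact hz0).
  assert (hw0 : (/ z)%C <> RtoC 0).
  { intros e. rewrite e Cmod_0 in hmod.
    assert (0 < / Cmod z) by (apply Rinv_0_lt_compat; lra). lra. }
  set (w0 := (/ z)%C) in *. clearbody w0. subst z.
  assert (hr := inv_rho_bounds rho hrho).
  assert (hr0 : 0 < / rho) by (apply Rinv_0_lt_compat; lra).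
  assert (hw0r : Cmod w0 <= / rho).
  { rewrite hmod. apply Rinv_le_contravar; lra. }
  destruct (Rle_lt_or_eq_dec _ _ hw0r) as [hlt|heq].
  - destruct (hres w0 hw0 hlt) as (Y & _ & h1 & h2 & h3).
    apply (resolvent_open A _ _ M Y hA hM h1 h2 h3).
    match goal with |- M * Cmod ?c <= _ => replace c with (RtoC 0) by ring end.
    rewrite Cmod_0. lra.
  - destruct (f_frac_radial_continuity alpha (/ rho) w0 halpha ltac:(lra) heq)
      as (Lc & hLc & hcont).
    assert (hML : 0 < M * Lc) by now apply Rmult_lt_0_compat.
    pose (e := Rmin (/ 2) (/ (2 * (M * Lc)))).
    assert (he : 0 < e).
    { unfold e. apply Rmin_case; apply Rinv_0_lt_compat; lra. }
    assert (he1 : e <= / 2) by apply Rmin_l.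
    assert (he2 : e <= / (2 * (M * Lc))) by apply Rmin_r.
    specialize (hcont (1 - e) ltac:(lra)).
    set (w := (RtoC (1 - e) * w0)%C) in *.
    assert (hw : w <> RtoC 0).
    { apply Cmult_neq_0; [|easy]. intros h; apply RtoC_inj in h; lra. }
    assert (hwr : Cmod w < / rho).
    { unfold w. rewrite Cmod_mult Cmod_R heq Rabs_pos_eq; [|lra].
      rewrite -{2}(Rmult_1_l (/ rho)). apply Rmult_lt_compat_r; lra. }
    destruct (hres w hw hwr) as (Y & _ & h1 & h2 & h3).
    apply (resolvent_open A _ _ M Y hA hM h1 h2 h3).
    eapply Rle_trans; [apply Rmult_le_compat_l; [lra|exact hcont]|].
    apply Rle_trans with (M * Lc * / (2 * (M * Lc))).
    + replace (M * (Lc * (1 - (1 - e)))) with (M * Lc * e) by ring.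
      apply Rmult_le_compat_l; lra.
    + right. field. split; lra.
Qed.

(** Invertibility of f(1/w) - A bounds the pencil from below for w <> 0; at w = 0 the
pencil is the identity, which is why the spectral condition extends to the whole
disc. *)
Lemma spectrum_pencil_below {H : HilbertSpace} (A : H -> H) (alpha rho : R) :
  is_linear A -> 0 < alpha < 1 -> 1 < rho ->
  (forall z, rho <= Cmod z -> ~ spectrum A (f_frac (RtoC alpha) z)) ->
  forall w, Cmod w <= / rho ->
    exists M, forall x, norm x <= M * norm (pencil A alpha w x).
Proof.
  intros hA halpha hrho hspec w hw.
  destruct (classic (w = RtoC 0)) as [->|hw0].
  - exists 1. intros x. unfold pencil. rewrite diff_symbol_0.
    replace (scal (RtoC 0) (A x)) with (zero : H) by (symmetry; exact (scal_zero_l _)).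
    rewrite minus_zero_r.
    rewrite Rmult_1_l. right. f_equal. symmetry. exact (scal_one _).
  - set (z := (/ w)%C).
    assert (hz : rho <= Cmod z).
    { unfold z. rewrite Cmod_inv; [|easy]. apply Cmod_gt_0 in hw0.
      rewrite -(Rinv_inv rho). now apply Rinv_le_contravar. }
    destruct (NNPP _ (hspec z hz)) as (B & hB & hl & _).
    destruct (linear_bound_nonneg B hB) as (b & hb & hbB).
    exists (b * Cmod z). intros x.
    rewrite -{1}(hl x). eapply Rle_trans; [apply hbB|].
    rewrite Rmult_assoc. apply Rmult_le_compat_l; [easy|].
    match goal with |- norm ?y <= _ => replace y with (scal z (pencil A alpha w x)) end.
    + apply (norm_scal_C (V := H)).
    + unfold pencil. rewrite scal_minus_distr_l !(scal_Cmult (V := H)) f_frac_symbol.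
      unfold z. replace (/ / w)%C with w by (field; exact hw0).
      f_equal. rewrite Cinv_l; [|easy]. exact (scal_one _).
Qed.

Theorem proposition4p6 (H : HilbertSpace) (Hsep : separable H)
  (rho alpha : R) (A : H -> H)
  (hrho : 1 < rho) (halpha : 0 < alpha < 1) (hA : is_linear A) :
  let T : (Z -> H) -> (Z -> H) := frac_op (RtoC alpha) A in
  let cond_i :=
    exists S : (Z -> H) -> (Z -> H),
      bounded_inverse_ell2 rho T S /\ causal rho S in
  let cond_ii :=
    exists S : (Z -> H) -> (Z -> H),
      bounded_inverse_ell2 rho T S /\
      forall (x : H) (n : Z), spt (S (delta (-1)%Z x)) n -> (0 <= n)%Z in
  let cond_iii :=
    forall mu : R, rho <= mu ->
      ~ exists lambda : C, ran_f (RtoC alpha) mu lambda /\ spectrum A lambda in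
  (cond_i <-> cond_ii) /\ (cond_ii <-> cond_iii).
Proof.
  intros T cond_i cond_ii cond_iii.
  assert (h12 : cond_i -> cond_ii).
  { intros (S & hS & hc). exists S. split; [easy|]. intros x n hn.
    destruct (Z.le_gt_cases 0 n) as [h|h]; [easy|]. exfalso. apply hn.
    now apply (causal_inverse_strict A alpha rho hA halpha hrho S hS hc). }
  assert (hstrict : forall S, bounded_inverse_ell2 rho T S ->
    (forall (x : H) (n : Z), spt (S (delta (-1)%Z x)) n -> (0 <= n)%Z) -> strictly_causal rho S).
  { intros S hS hd. apply (strictly_causal_of_delta A alpha rho hrho S hS).
    intros x n hn. apply NNPP. intros h. specialize (hd x n h). lia. }
  assert (h21 : cond_ii -> cond_i).
  { intros (S & hS & hd). exists S. split; [easy|]. intros a g hg hsupp n hn.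
    destruct (Z.le_gt_cases a n) as [h|h]; [easy|]. exfalso. apply hn.
    apply (hstrict S hS hd a g hg); [|lia].
    intros m hm. apply NNPP. intros hne. specialize (hsupp m hne). lia. }
  assert (h23 : cond_ii -> cond_iii).
  { intros (S & hS & hd) mu hmu (lambda & (z & hz & ->) & hspec).
    revert hspec. apply (strictly_causal_spectrum A alpha rho S hA halpha hrho hS (hstrict S hS hd)).
    lra. }
  assert (h31 : cond_iii -> cond_i).
  { intros hiii. apply (frac_op_causal_inverse A alpha rho hA halpha hrho).
    apply (spectrum_pencil_below A alpha rho hA halpha hrho).
    intros z hz hspec. apply (hiii (Cmod z) hz). exists (f_frac (RtoC alpha) z).
    split; [now exists z|easy]. }
  tauto.
Qed.
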